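(* Let $(c,\lambda/\mu)$ be a placed skew shape with $n$ boxes, let $\tilde H^{(c,\lambda/\mu)}$ be the associated $\tilde H_n$-module, let $\{n_L\}$ ($L$ running over the standard tableaux of shape $\lambda/\mu$) be its natural basis, and let $C$ be the column reading tableau of shape $\lambda/\mu$. (a) If $i$ and $i+1$ are entries in the same column of $C$ then $T_i\,n_C=-q^{-1}n_C$. (b) Fix a snake in $\lambda/\mu$, determined by a pair of adjacent boxes $b$ (left) and $b'$ (right) in the same row. Let the entries of $C$ in the snake be $i,i+1,\dots,j$ in the column of $b$ (with $i$ in box $b$) and $j+1,\dots,\ell$ in the column of $b'$ (with $\ell$ in box $b'$). Let $P$ be the standard tableau which has all entries the same as $C$ except that the entries in the snake are entered in row reading order instead of in column reading order, and let $k$ be the entry of $P$ in box $b$ (so $k+1$ is the entry of $P$ in box $b'$). Let $S_A$, $S_B$, $S_{A\cup B}$ be the subgroups of $S_n$ consisting of the permutations of $A=\{i,i+1,\dots,j\}$, $B=\{j+1,\dots,\ell\}$ and $A\cup B$, respectively, and let $S_{A\cup B}/(S_A\times S_B)$ denote the set of minimal length coset representatives of the cosets $w(S_A\times S_B)$ in $S_{A\cup B}$. Then $$0=\Bigg(\sum_{u\in S_{A\cup B}/(S_A\times S_B)}(-q)^{\ell(w_{A\cup B})-\ell(w_Aw_B)-\ell(u)}\,T_u\Bigg)n_C = T_k\,n_P+\sum_{u}(-q)^{\ell(w_{A\cup B})-\ell(w_Aw_B)-\ell(u)}\,n_{uC},$$ where $\ell(w_{A\cup B})=\binom{\ell-i+1}{2}$,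 $\ell(w_Aw_B)=\binom{j-i+1}{2}+\binom{\ell-j}{2}$, $\ell(u)$ is the length of $u$, and the last sum is over all $u$ such that $uC$ is a standard tableau obtained from $C$ by permuting entries which are in the snake (i.e. $u\in S_{A\cup B}$ with $uC$ standard).
   Context: **Algebra.** Let $n\ge 1$ and let $q$ be a positive real number, $q\neq 1$. The affine Hecke algebra $\tilde H_n$ is the unital associative $\mathbb C$-algebra generated by $T_1,\dots,T_{n-1}$ and invertible elements $x_1,\dots,x_n$ with relations: $T_iT_j=T_jT_i$ if $|i-j|>1$; $T_iT_{i+1}T_i=T_{i+1}T_iT_{i+1}$ for $1\le i\le n-2$; $T_i^2=(q-q^{-1})T_i+1$; $x_ix_j=x_jx_i$; and for $\gamma\in\mathbb Z^n$, $x^\gamma=x_1^{\gamma_1}\cdots x_n^{\gamma_n}$, $$x^\gamma T_i=T_ix^{s_i\gamma}+(q-q^{-1})\frac{(x^\gamma-x^{s_i\gamma})x_{i+1}}{x_{i+1}-x_i},$$ where $s_i=(i,i+1)$ swaps coordinates $i,i+1$ of $\gamma$. For $w\in S_n$ with reduced word $w=s_{i_1}\cdots s_{i_p}$, $T_w=T_{i_1}\cdots T_{i_p}$ (independent of the reduced word) and $\ell(w)=p$. **Skew shapes.** Partitions are drawn with boxes pushed up and to the left; rows numbered top to bottom, columns left to right. For partitions $\mu\subseteq\lambda$, the skew shape $\lambda/\mu$ is the set of boxes of $\lambda$ not in $\mu$. A box in row $r$, column $s$ lies on the diagonal of index $s-r$. The $n$ boxes are numbered $\mathrm{box}_1,\dots,\mathrm{box}_n$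 along diagonals, from southwest to northeast (increasing index), and northwest to southeast within a diagonal. A standard tableau of shape $\lambda/\mu$ is a filling of the boxes with $1,\dots,n$ (each once) increasing left to right in rows and top to bottom in columns. The column reading tableau $C$ is obtained by entering $1,2,\dots,n$ consecutively down the columns of $\lambda/\mu$, beginning with the southwest-most connected component and filling the columns from left to right. For a tableau $L$ and $w\in S_n$, $wL$ is the filling obtained by replacing each entry $e$ by $w(e)$. **Snakes.** A pair of adjacent boxes in the same row of $\lambda/\mu$ determines a *snake* in $\lambda/\mu$, consisting of the two boxes of the pair, all boxes of $\lambda/\mu$ above the right-hand box of the pair in its column, and all boxes of $\lambda/\mu$ below the left-hand box of the pair in its column. ''Entered in row reading order'' means that the entries of $C$ in the snake are re-entered in increasing order left to right across rows, from the top row to the bottom row of the snake. **Placed skew shapes.** A placed skew shape is a pair $(c,\lambda/\mu)$ with $\lambda/\mu$ a skew shape and $c$ a content function from the boxes of $\lambda/\mu$ to $\{a+b\sqrt{-1} : a\in\mathbb R,\ 0\le b<2\pi/|\ln(q^2)|\}$ such that for all $i,j$: $c(\mathrm{box}_j)\ge c(\mathrm{box}_i)$ if $i<j$ and $c(\mathrm{box}_j)-c(\mathrm{box}_i)\in\mathbb Z$; $c(\mathrm{box}_j)=c(\mathrm{box}_i)+1$ iff the diagonal index of $\mathrm{box}_j$ is one more than that of $\mathrm{box}_i$; $c(\mathrm{box}_i)=c(\mathrm{box}_j)$ iff they are on the same diagonal. Here $q^{2z}=e^{z\ln(q^2)}$. **The module and natural basis.** $\tilde H^{(c,\lambda/\mu)}$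 is the $\tilde H_n$-module with $\mathbb C$-basis $\{v_L\}$, $L$ running over standard tableaux of shape $\lambda/\mu$, and action $$x_iv_L=q^{2c(L(i))}v_L,\qquad T_iv_L=(T_i)_{LL}v_L+(q^{-1}+(T_i)_{LL})v_{s_iL},\qquad (T_i)_{LL}=\frac{q-q^{-1}}{1-q^{2(c(L(i))-c(L(i+1)))}},$$ where $L(i)$ is the box of $L$ containing $i$ and $v_{s_iL}=0$ if $s_iL$ is not standard. The natural basis is $\{n_L\}$ with $n_L=T_wv_C$, where $w\in S_n$ is the permutation with $L=wC$ (in particular $n_C=v_C$). *)

(* Defs.v *)
From HB Require Import structures.
From mathcomp Require Import all_boot all_order all_algebra all_fingroup.
From mathcomp Require Import boolp classical_sets reals sequences exp trigo.
From mathcomp Require Import complex generic_quotient.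
From mathcomp Require Import ring.

Set Implicit Arguments.
Unset Strict Implicit.
Unset Printing Implicit Defensive.

Import Order.TTheory GRing.Theory Num.Theory.

Local Open Scope ring_scope.
Local Open Scope quotient_scope.

(** Indices 1, ..., n of the mathematical text are shifted to 0, ..., n-1:
    the x_j are indexed by j : 'I_n, and T_i and the simple transposition s_i,
    which exchanges i and i+1, by i : 'I_n.-1. *)

Section SimpleTranspositions.
Variable n : nat.

Definition ord_lo (i : 'I_n.-1) : 'I_n := widen_ord (leq_pred n) i.

Lemma ord_hi_subproof (i : 'I_n.-1) : (i.+1 < n)%N.
Proof. by case: n i => [|m] [i lti]. Qed.

Definition ord_hi (i : 'I_n.-1) : 'I_n := Ordinal (ord_hi_subproof i).

Definition simple_tperm (i : 'I_n.-1) : 'S_n := tperm (ord_lo i) (ord_hi i).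

(** The word i_1 ... i_p stands for s_{i_1} o ... o s_{i_p}, composed as
    functions; in [{perm _}] the product [(s * t)%g] is [t \o s]. *)
Definition word_perm (s : seq 'I_n.-1) : 'S_n :=
  foldr (fun i w => (w * simple_tperm i)%g) 1%g s.

Definition reduced_word_of (w : 'S_n) (s : seq 'I_n.-1) : Prop :=
  word_perm s = w /\
  forall t, word_perm t = w -> (size s <= size t)%N.

Definition reduced_word (w : 'S_n) : seq 'I_n.-1 :=
  xget [::] [set s | reduced_word_of w s]%classic.

Definition perm_len (w : 'S_n) : nat := size (reduced_word w).

Lemma word_perm_cat s t :
  word_perm (s ++ t) = (word_perm t * word_perm s)%g.
Proof. by elim: s => [|i s IHs] /=; rewrite ?mulg1 // IHs mulgA. Qed.

Lemma word_perm_surj (w : 'S_n) : exists s, word_perm s = w.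
Proof.
suff tpermW (x y : 'I_n) : exists s, word_perm s = tperm x y.
  have [ts -> _] := prod_tpermP w.
  elim: ts => [|t ts [s IHs]]; first by exists [::]; rewrite big_nil.
  have [u tE] := tpermW t.1 t.2.
  by exists (s ++ u); rewrite big_cons word_perm_cat tE IHs.
wlog lexy : x y / (x <= y)%N.
  by move=> H; case/orP: (leq_total x y) => /H //; rewrite tpermC.
case: y lexy => m; elim: m => [|m IHm] lt_m_n /= lexm.
  exists [::]; rewrite (_ : Ordinal _ = x) ?tperm1 //.
  by apply: val_inj => /=; apply/esym/eqP; rewrite -leqn0.
move: lexm; rewrite leq_eqVlt => /orP[/eqP xE|ltxm].
  by exists [::]; rewrite (_ : Ordinal _ = x) ?tperm1 //; apply: val_inj.
have lt_m_n1 : (m < n.-1)%N by rewrite -ltnS prednK // (leq_trans _ lt_m_n).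
pose i : 'I_n.-1 := Ordinal lt_m_n1.
have [s] := IHm (ltnW lt_m_n) ltxm.
rewrite (_ : Ordinal _ = ord_lo i) => [sE|]; last exact: val_inj.
have hiE : ord_hi i = Ordinal lt_m_n by apply: val_inj.
have [xlo|xlo] := eqVneq x (ord_lo i).
  exists [:: i]; rewrite /= mul1g /simple_tperm hiE xlo.
  by [].
exists (i :: s ++ [:: i]).
rewrite -cat1s !word_perm_cat /= mul1g sE /simple_tperm hiE.
set a := ord_lo i; set b := Ordinal lt_m_n.
have -> : tperm x b = (tperm x a ^ tperm a b)%g.
  rewrite tpermJ tpermL tpermD 1?eq_sym //.
  by apply: contraTneq ltxm => ->; rewrite -leqNgt.
by rewrite conjgE tpermV mulgA.
Qed.

Lemma reduced_wordP (w : 'S_n) : reduced_word_of w (reduced_word w).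
Proof.
have [s sE] := word_perm_surj w.
suff [t tP] : exists t, reduced_word_of w t.
  by rewrite /reduced_word; case: xgetP => [? _ //|/(_ t)].
have exP : exists k, `[< exists2 t, word_perm t = w & size t = k >].
  by exists (size s); apply/asboolP; exists s.
case: (ex_minnP exP) => k /asboolP[t tE tk] kmin.
exists t; split=> // u uE; rewrite tk; apply: kmin.
by apply/asboolP; exists u.
Qed.

End SimpleTranspositions.

Section LaurentMonomials.
Variables (A : nzRingType) (n : nat) (x xV : 'I_n -> A).

Definition xpow (j : 'I_n) (m : int) : A :=
  match m with Posz k => x j ^+ k | Negz k => xV j ^+ k.+1 end.

Definition xmon (g : 'I_n -> int) : A := \prod_(j < n) xpow j (g j).

Definition upd2 (i : 'I_n.-1) (g : 'I_n -> int) (a b : int) : 'I_n -> int :=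
  fun j => if j == ord_lo i then a else if j == ord_hi i then b else g j.

(** The quotient (x^g - x^{s_i g}) x_{i+1} / (x_{i+1} - x_i) in the Laurent
    polynomials, written out as a geometric sum; [xquotP] below shows that it
    is this quotient. *)
Definition xquot (i : 'I_n.-1) (g : 'I_n -> int) : A :=
  let a := g (ord_lo i) in let b := g (ord_hi i) in
  if a <= b then \sum_(r < `|b - a|%N) xmon (upd2 i g (b - 1 - r%:Z) (a + 1 + r%:Z))
  else - \sum_(r < `|a - b|%N) xmon (upd2 i g (a - 1 - r%:Z) (b + 1 + r%:Z)).

Definition swap_exp (i : 'I_n.-1) (g : 'I_n -> int) : 'I_n -> int :=
  fun j => g (simple_tperm i j).

End LaurentMonomials.

Definition hecke_relations (K : fieldType) (n : nat) (q : K) (A : algType K)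
    (T : 'I_n.-1 -> A) (x xV : 'I_n -> A) : Prop :=
  [/\ forall i j : 'I_n.-1, (i.+1 < j)%N || (j.+1 < i)%N -> T i * T j = T j * T i,
      forall i j : 'I_n.-1, j = i.+1 :> nat -> T i * T j * T i = T j * T i * T j,
      forall i, T i ^+ 2 = (q - q^-1) *: T i + 1,
      (forall j, x j * xV j = 1 /\ xV j * x j = 1) /\
        (forall j k, x j * x k = x k * x j)
    & forall (g : 'I_n -> int) i,
        xmon x xV g * T i =
        T i * xmon x xV (swap_exp i g) + (q - q^-1) *: xquot x xV i g].

Section XQuot.
Variables (A : nzRingType) (n : nat) (x xV : 'I_n -> A).
Hypothesis xK : forall j, x j * xV j = 1 /\ xV j * x j = 1.
Hypothesis xC : forall j k, x j * x k = x k * x j.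

Let comm_xxV j k : GRing.comm (x j) (xV k).
Proof.
rewrite /GRing.comm -[LHS]mul1r -(xK k).2 -!mulrA [x k * _]mulrA -xC -!mulrA.
by rewrite (xK k).1 mulr1.
Qed.

Let comm_xpow j k m : GRing.comm (x j) (xpow x xV k m).
Proof. by case: m => m; apply: commrX; [exact: xC | exact: comm_xxV]. Qed.

Let xpowS j m : xpow x xV j m * x j = xpow x xV j (m + 1).
Proof.
case: m => m.
  by rewrite (_ : Posz m + 1 = Posz m.+1) /= ?exprSr // -addn1 PoszD.
rewrite /= exprSr -mulrA (xK j).2 mulr1.
have -> : Negz m + 1 = - m%:Z by rewrite NegzE -addn1 PoszD opprD addrNK.
by case: m.
Qed.

Let xmonS (g h : 'I_n -> int) k : h k = g k + 1 ->
  (forall j, j != k -> h j = g j) -> xmon x xV g * x k = xmon x xV h.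
Proof.
move=> hk hj; rewrite /xmon.
have kn := mem_index_enum k; have ku := index_enum_uniq 'I_n.
have comm_prod (s : seq 'I_n) (P : 'I_n -> int) :
    GRing.comm (x k) (\prod_(j <- s) xpow x xV j (P j)).
  by apply: big_ind => [|? ?|? _]; [exact: commr1 | exact: commrM | exact: comm_xpow].
elim: (index_enum _) kn ku => // j s IHs; rewrite inE => + /= /andP[jNs us].
have [jk _|jk /= ks] := eqVneq k j.
  rewrite !big_cons -jk -mulrA -comm_prod mulrA xpowS -hk; congr (_ * _).
  apply: eq_big_seq => l ls; rewrite hj //.
  by apply: contraNneq jNs => lk; rewrite -jk -lk.
rewrite !big_cons -mulrA IHs //; congr (xpow _ _ _ _ * _).
by rewrite hj // eq_sym.
Qed.

Let lo_neq_hi (i : 'I_n.-1) : (ord_lo i == ord_hi i) = false.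
Proof. by apply/eqP => /(congr1 val) /= /eqP; rewrite eqn_leq ltnn andbF. Qed.

Let xmon_upd_lo i g a b : xmon x xV (upd2 i g a b) * x (ord_lo i) =
  xmon x xV (upd2 i g (a + 1) b).
Proof.
by apply: xmonS => [|j /negPf jN]; rewrite /upd2 ?eqxx // jN.
Qed.

Let xmon_upd_hi i g a b : xmon x xV (upd2 i g a b) * x (ord_hi i) =
  xmon x xV (upd2 i g a (b + 1)).
Proof.
by apply: xmonS => [|j /negPf jN]; rewrite /upd2 ?jN // eq_sym lo_neq_hi eqxx.
Qed.

Let xmon_ext g h : g =1 h -> xmon x xV g = xmon x xV h.
Proof. by move=> gh; apply: eq_bigr => j _; rewrite gh. Qed.

Let geom_sum i g (a b : int) d : b = a + d%:Z ->
  (\sum_(r < d) xmon x xV (upd2 i g (b - 1 - r%:Z) (a + 1 + r%:Z))) *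
    (x (ord_hi i) - x (ord_lo i)) =
  xmon x xV (upd2 i g a (b + 1)) - xmon x xV (upd2 i g b (a + 1)).
Proof.
move=> bE; rewrite mulr_suml.
pose F (r : nat) := xmon x xV (upd2 i g (b - r%:Z) (a + 1 + r%:Z)).
rewrite (eq_bigr (fun r : 'I_d => F r.+1 - F r)) => [|r _].
  rewrite -(big_mkord xpredT (fun r => F r.+1 - F r)) telescope_sumr //.
  rewrite /F subr0 addr0; congr (xmon _ _ (upd2 _ _ _ _) - _).
    by rewrite bE addrK.
  by rewrite bE addrAC.
rewrite mulrBr xmon_upd_hi xmon_upd_lo /F -addn1 PoszD.
have -> : b - (r%:Z + 1%N) = b - 1 - r%:Z by ring.
by rewrite [a + 1 + (_ + _)]addrA (_ : b - 1 - r%:Z + 1 = b - r%:Z) //; ring.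
Qed.

Lemma xquotP i g : xquot x xV i g * (x (ord_hi i) - x (ord_lo i)) =
  (xmon x xV g - xmon x xV (swap_exp i g)) * x (ord_hi i).
Proof.
have gE : xmon x xV g * x (ord_hi i) =
    xmon x xV (upd2 i g (g (ord_lo i)) (g (ord_hi i) + 1)).
  rewrite -xmon_upd_hi; congr (_ * _); apply: xmon_ext => j.
  by rewrite /upd2; case: eqP => [->|_] //; case: eqP => [->|_].
have sgE : xmon x xV (swap_exp i g) * x (ord_hi i) =
    xmon x xV (upd2 i g (g (ord_hi i)) (g (ord_lo i) + 1)).
  rewrite -xmon_upd_hi; congr (_ * _); apply: xmon_ext => j.
  rewrite /upd2 /swap_exp /simple_tperm; case: tpermP => [->|->|].
  - by rewrite eqxx.
  - by rewrite eq_sym lo_neq_hi eqxx.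
  - by move=> /eqP/negPf-> /eqP/negPf->.
rewrite mulrBl gE sgE /xquot; case: ifP => [leab|/negbT].
  by apply: geom_sum; rewrite gez0_abs ?subr_ge0 // subrKC.
rewrite -ltNge => /ltW leba; rewrite mulNr (@geom_sum i g _ _ `|_ - _|) ?opprB //.
by rewrite gez0_abs ?subr_ge0 // subrKC.
Qed.

End XQuot.

(** T_i = q, x_j = q^(2j) (or T_i = x_j = 1 if q = q^-1) is a one-dimensional
    representation; it shows that 1 != 0 in the presented algebra. *)
Lemma hecke_relations1 (K : fieldType) (n : nat) (q : K) :
  exists (T : 'I_n.-1 -> K^o) x xV, hecke_relations q T x xV.
Proof.
have [qq|qq] := eqVneq q q^-1.
  have qq0 : q - q^-1 = 0 by rewrite {1}qq subrr.
  exists (fun=> 1), (fun=> 1), (fun=> 1); split; rewrite ?qq0 //.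
  - by move=> i; rewrite scale0r add0r expr1n.
  - by split=> // j; rewrite mulr1.
  - have x1 g : xmon (fun _ : 'I_n => 1 : K^o) (fun=> 1) g = 1.
      by rewrite /xmon big1 // => j _; case: (g j) => m /=; rewrite expr1n.
    by move=> g i; rewrite scale0r addr0 !x1.
have q0 : q != 0 by apply: contraNneq qq => ->; rewrite invr0.
have q21 : q ^+ 2 != 1.
  by apply: contraNneq qq => q21; apply/eqP/(mulfI q0); rewrite mulfV // -expr2.
pose x (j : 'I_n) : K^o := (q ^+ 2) ^+ j.
have x0 j : x j != 0 by rewrite !expf_neq0.
have xK j : x j * (x j)^-1 = 1 /\ (x j)^-1 * x j = 1.
  by rewrite mulfV ?mulVf.
have xC j k : x j * x k = x k * x j by rewrite mulrC.
exists (fun=> q), x, (fun j => (x j)^-1); split=> //.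
- by move=> i; rewrite /GRing.scale /= mulrBl mulVf // -expr2 subrK.
- have key (u v Q y z : K) : z != 0 -> y = q ^+ 2 * z ->
      Q * (y - z) = (u - v) * y -> u * q = q * v + (q - q^-1) * Q.
    move=> z0 -> QE; have d0 : q ^+ 2 * z - z != 0.
      by rewrite -[X in _ - X]mul1r -mulrBl mulf_neq0 ?subr_eq0.
    by apply: (mulIf d0); rewrite mulrDl -[_ * Q * _]mulrA QE; field.
  move=> g i; apply: (key _ _ _ (x (ord_hi i)) (x (ord_lo i)) (x0 _)).
    exact: (exprS (q ^+ 2) (ord_lo i)).
  exact: (xquotP xK xC i g).
Qed.

(** The algebra presented by generators and relations: formal expressions in
    the generators modulo the equalities that hold in every algebra whose
    elements T_i, x_j, x_j^-1 satisfy the relations *)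
Inductive hecke_term (K : fieldType) (n : nat) :=
  | HConst of K
  | HT of 'I_n.-1
  | HX of 'I_n
  | HXV of 'I_n
  | HAdd of hecke_term K n & hecke_term K n
  | HMul of hecke_term K n & hecke_term K n.

Section HeckeTerms.
Variables (K : fieldType) (n : nat) (q : K).
Local Notation term := (hecke_term K n).

Section Eval.
Variables (A : algType K) (T : 'I_n.-1 -> A) (x xV : 'I_n -> A).

Fixpoint hecke_eval (t : term) : A :=
  match t with
  | HConst a => a%:A
  | HT i => T i
  | HX j => x j
  | HXV j => xV j
  | HAdd s t => hecke_eval s + hecke_eval t
  | HMul s t => hecke_eval s * hecke_eval t
  end.

End Eval.

Definition hecke_equiv (s t : term) : Prop :=
  forall (A : algType K) (T : 'I_n.-1 -> A) x xV,
    hecke_relations q T x xV -> hecke_eval T x xV s = hecke_eval T x xV t.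

Definition hecke_equivb (s t : term) : bool := `[< hecke_equiv s t >].

Lemma hecke_equivb_refl : reflexive hecke_equivb.
Proof. by move=> t; apply/asboolP. Qed.

Lemma hecke_equivb_sym : symmetric hecke_equivb.
Proof.
by move=> s t; apply/asboolP/asboolP => st A T x xV /st ->.
Qed.

Lemma hecke_equivb_trans : transitive hecke_equivb.
Proof.
move=> t s u /asboolP st /asboolP tu; apply/asboolP => A T x xV r.
by rewrite (st _ _ _ _ r) tu.
Qed.

End HeckeTerms.

HB.instance Definition _ (K : fieldType) n := gen_eqMixin (hecke_term K n).
HB.instance Definition _ (K : fieldType) n := gen_choiceMixin (hecke_term K n).

Canonical hecke_equivb_rel (K : fieldType) n (q : K) :=
  EquivRel (@hecke_equivb K n q) (@hecke_equivb_refl K n q)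
    (@hecke_equivb_sym K n q) (@hecke_equivb_trans K n q).

Definition affine_hecke (K : fieldType) (n : nat) (q : K) :=
  {eq_quot @hecke_equivb K n q}.

Arguments affine_hecke {K} n q.

Section HeckeAlgebra.
Variables (K : fieldType) (n : nat) (q : K).
Local Notation H := (affine_hecke n q).
Local Notation term := (hecke_term K n).

HB.instance Definition _ := Choice.on H.
HB.instance Definition _ := Quotient.on H.

Definition hecke_lift (A : algType K) T x xV (h : H) : A :=
  hecke_eval T x xV (repr h).

Lemma hecke_lift_pi (A : algType K) T x xV (t : term) :
  hecke_relations q T x xV ->
  hecke_lift T x xV (\pi_H t) = hecke_eval T x xV t :> A.
Proof.
have /eqmodP/asboolP tE := reprK (\pi_H t).
by move=> r; rewrite /hecke_lift tE.
Qed.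

Lemma hecke_ext (g h : H) :
  (forall (A : algType K) (T : 'I_n.-1 -> A) x xV, hecke_relations q T x xV ->
    hecke_lift T x xV g = hecke_lift T x xV h) -> g = h.
Proof.
by move=> gh; rewrite -(reprK g) -(reprK h); apply/eqmodP/asboolP.
Qed.

Definition hecke_const (a : K) : H := \pi_H (HConst n a).
Definition hecke_add (g h : H) : H := \pi_H (HAdd (repr g) (repr h)).
Definition hecke_mul (g h : H) : H := \pi_H (HMul (repr g) (repr h)).
Definition hecke_opp (h : H) : H := hecke_mul (hecke_const (- 1)) h.
Definition hecke_scale (a : K) (h : H) : H := hecke_mul (hecke_const a) h.

Section Lift.
Variables (A : algType K) (T : 'I_n.-1 -> A) (x xV : 'I_n -> A).
Hypothesis r : hecke_relations q T x xV.

Lemma hecke_lift_const a : hecke_lift T x xV (hecke_const a) = a%:A.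
Proof. exact: hecke_lift_pi. Qed.

Lemma hecke_lift_add g h : hecke_lift T x xV (hecke_add g h) =
  hecke_lift T x xV g + hecke_lift T x xV h.
Proof. exact: hecke_lift_pi. Qed.

Lemma hecke_lift_mul g h : hecke_lift T x xV (hecke_mul g h) =
  hecke_lift T x xV g * hecke_lift T x xV h.
Proof. exact: hecke_lift_pi. Qed.

Lemma hecke_lift_opp h : hecke_lift T x xV (hecke_opp h) = - hecke_lift T x xV h.
Proof.
by rewrite hecke_lift_mul hecke_lift_const mulr_algl scaleN1r.
Qed.

Lemma hecke_lift_scale a h :
  hecke_lift T x xV (hecke_scale a h) = a *: hecke_lift T x xV h.
Proof. by rewrite hecke_lift_mul hecke_lift_const mulr_algl. Qed.

Definition hecke_liftE :=
  (hecke_lift_opp, hecke_lift_scale, hecke_lift_const, hecke_lift_add, hecke_lift_mul).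

End Lift.

Local Ltac lift := move=> *; apply: hecke_ext => ? ? ? ?;
  let r := fresh in move=> r; rewrite !(hecke_liftE r).

Fact hecke_addA : associative hecke_add.
Proof. by lift; rewrite addrA. Qed.

Fact hecke_addC : commutative hecke_add.
Proof. by lift; rewrite addrC. Qed.

Fact hecke_add0 : left_id (hecke_const 0) hecke_add.
Proof. by lift; rewrite scale0r add0r. Qed.

Fact hecke_addN : left_inverse (hecke_const 0) hecke_opp hecke_add.
Proof. by lift; rewrite scale0r addNr. Qed.

HB.instance Definition _ := GRing.isZmodule.Build H
  hecke_addA hecke_addC hecke_add0 hecke_addN.

Fact hecke_mulA : associative hecke_mul.
Proof. by lift; rewrite mulrA. Qed.

Fact hecke_mul1 : left_id (hecke_const 1) hecke_mul.
Proof. by lift; rewrite scale1r mul1r. Qed.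

Fact hecke_mulr1 : right_id (hecke_const 1) hecke_mul.
Proof. by lift; rewrite scale1r mulr1. Qed.

Fact hecke_mulDl : left_distributive hecke_mul hecke_add.
Proof. by lift; rewrite mulrDl. Qed.

Fact hecke_mulDr : right_distributive hecke_mul hecke_add.
Proof. by lift; rewrite mulrDr. Qed.

Fact hecke_1_neq0 : hecke_const 1 != hecke_const 0.
Proof.
have [T [x [xV r]]] := hecke_relations1 n q.
apply/eqP => /(congr1 (hecke_lift T x xV)); rewrite !(hecke_liftE r).
by apply/eqP; rewrite scale1r scale0r oner_neq0.
Qed.

HB.instance Definition _ := GRing.Zmodule_isNzRing.Build H
  hecke_mulA hecke_mul1 hecke_mulr1 hecke_mulDl hecke_mulDr hecke_1_neq0.

Fact hecke_scaleA a b h :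
  hecke_scale a (hecke_scale b h) = hecke_scale (a * b) h.
Proof. by lift; rewrite scalerA. Qed.

Fact hecke_scale1 : left_id 1 hecke_scale.
Proof. by lift; rewrite scale1r. Qed.

Fact hecke_scaleDr : right_distributive hecke_scale +%R.
Proof. by lift; rewrite scalerDr. Qed.

Fact hecke_scaleDl h : {morph hecke_scale^~ h : a b / a + b}.
Proof. by lift; rewrite scalerDl. Qed.

HB.instance Definition _ := GRing.Zmodule_isLmodule.Build K H
  hecke_scaleA hecke_scale1 hecke_scaleDr hecke_scaleDl.

Fact hecke_scaleAl (a : K) (g h : H) : a *: (g * h) = (a *: g) * h.
Proof. by lift; rewrite scalerAl. Qed.

HB.instance Definition _ := GRing.Lmodule_isLalgebra.Build K H hecke_scaleAl.

Fact hecke_scaleAr (a : K) (g h : H) : a *: (g * h) = g * (a *: h).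
Proof. by lift; rewrite scalerAr. Qed.

HB.instance Definition _ := GRing.Lalgebra_isAlgebra.Build K H hecke_scaleAr.

Definition heckeT (i : 'I_n.-1) : H := \pi_H (HT K i).
Definition heckeX (j : 'I_n) : H := \pi_H (HX K j).
Definition heckeXV (j : 'I_n) : H := \pi_H (HXV K j).

End HeckeAlgebra.

Section Presentation.
Variables (K : fieldType) (n : nat) (q : K).
Local Notation H := (affine_hecke n q).

Section Morphism.
Variables (A : algType K) (T : 'I_n.-1 -> A) (x xV : 'I_n -> A).

Definition hecke_morph (r : hecke_relations q T x xV) : H -> A :=
  hecke_lift T x xV.

Hypothesis r : hecke_relations q T x xV.

Fact hecke_morph_is_zmod : zmod_morphism (hecke_morph r).
Proof.
move=> g h; rewrite /hecke_morph [g - h]/(hecke_add g (hecke_opp h)).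
by rewrite !(hecke_liftE r).
Qed.

Fact hecke_morph_is_monoid : monoid_morphism (hecke_morph r).
Proof.
split=> [|g h]; last by rewrite /hecke_morph (hecke_lift_mul r).
by rewrite /hecke_morph (hecke_lift_const r) scale1r.
Qed.

Fact hecke_morph_is_scalable : scalable (hecke_morph r).
Proof. by move=> a h; rewrite /hecke_morph (hecke_lift_scale r). Qed.

HB.instance Definition _ := GRing.isZmodMorphism.Build H A (hecke_morph r)
  hecke_morph_is_zmod.
HB.instance Definition _ := GRing.isMonoidMorphism.Build H A (hecke_morph r)
  hecke_morph_is_monoid.
HB.instance Definition _ := GRing.isScalable.Build K H A *:%R (hecke_morph r)
  hecke_morph_is_scalable.

Lemma hecke_morphT i : hecke_morph r (heckeT q i) = T i.
Proof. exact: (hecke_lift_pi (HT K i) r). Qed.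

Lemma hecke_morphX j : hecke_morph r (heckeX q j) = x j.
Proof. exact: (hecke_lift_pi (HX K j) r). Qed.

Lemma hecke_morphXV j : hecke_morph r (heckeXV q j) = xV j.
Proof. exact: (hecke_lift_pi (HXV K j) r). Qed.

Lemma hecke_morph_xmon g :
  hecke_morph r (xmon (@heckeX K n q) (@heckeXV K n q) g) = xmon x xV g.
Proof.
rewrite rmorph_prod; apply: eq_bigr => j _; case: (g j) => m /=.
  by rewrite rmorphXn /= hecke_morphX.
by rewrite rmorphXn /= hecke_morphXV.
Qed.

Lemma hecke_morph_xquot i g :
  hecke_morph r (xquot (@heckeX K n q) (@heckeXV K n q) i g) = xquot x xV i g.
Proof.
rewrite /xquot; case: ifP => _; rewrite ?rmorphN rmorph_sum;
  do ?congr (- _); by apply: eq_bigr => k _; exact: hecke_morph_xmon.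
Qed.

End Morphism.

Lemma hecke_eq (g h : H) :
  (forall (A : algType K) (T : 'I_n.-1 -> A) x xV (r : hecke_relations q T x xV),
    hecke_morph r g = hecke_morph r h) -> g = h.
Proof. by move=> gh; apply: hecke_ext => A T x xV r; apply: (gh A T x xV r). Qed.

Theorem affine_heckeP :
  hecke_relations q (@heckeT K n q) (@heckeX K n q) (@heckeXV K n q).
Proof.
have E := (hecke_morphT, hecke_morphX, hecke_morphXV).
split.
- move=> i j ij; apply: hecke_eq => A T x xV r; have [TC _ _ _ _] := r.
  by rewrite !rmorphM /= !E TC.
- move=> i j ij; apply: hecke_eq => A T x xV r; have [_ TB _ _ _] := r.
  by rewrite !rmorphM /= !E TB.
- move=> i; apply: hecke_eq => A T x xV r; have [_ _ TQ _ _] := r.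
  by rewrite rmorphD rmorph1 /= linearZ /= rmorphXn /= !E TQ.
- split=> [j|j k].
    split; apply: hecke_eq => A T x xV r; have [_ _ _ [xK _] _] := r;
    by rewrite rmorphM rmorph1 /= !E ?(xK j).1 ?(xK j).2.
  apply: hecke_eq => A T x xV r; have [_ _ _ [_ xC] _] := r.
  by rewrite !rmorphM /= !E xC.
- move=> g i; apply: hecke_eq => A T x xV r; have [_ _ _ _ TX] := r.
  rewrite rmorphD /= linearZ /= !rmorphM /= !hecke_morph_xmon hecke_morph_xquot.
  by rewrite hecke_morphT TX.
Qed.

Theorem affine_hecke_universal (A : algType K) T x xV :
  hecke_relations q T x xV ->
  exists2 f : {lrmorphism H -> A},
    [/\ forall i, f (heckeT q i) = T i, forall j, f (heckeX q j) = x j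
      & forall j, f (heckeXV q j) = xV j] &
    forall g : {lrmorphism H -> A},
      [/\ forall i, g (heckeT q i) = T i, forall j, g (heckeX q j) = x j
        & forall j, g (heckeXV q j) = xV j] -> g =1 f.
Proof.
move=> r; exists (hecke_morph r : {lrmorphism H -> A}).
  by split=> [i|j|j] /=; [exact: hecke_morphT|exact: hecke_morphX|exact: hecke_morphXV].
move=> g [gT gX gXV] h; rewrite -(reprK h) /=.
have mE := (hecke_lift_pi _ r).
rewrite [RHS]mE; elim: (repr h) => /= [a|i|j|j|s IHs t IHt|s IHs t IHt].
- have -> : \pi_H (HConst n a) = a%:A.
    apply: hecke_eq => B T' x' xV' r'; rewrite linearZ rmorph1.
    exact: (hecke_lift_const r').
  by rewrite linearZ rmorph1.
- exact: gT.
- exact: gX.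
- exact: gXV.
- have -> : \pi_H (HAdd s t) = \pi_H s + \pi_H t.
    apply: hecke_ext => B T' x' xV' r'.
    by rewrite (hecke_lift_add r') !(hecke_lift_pi _ r').
  by rewrite -IHs -IHt; apply: (rmorphD g).
- have -> : \pi_H (HMul s t) = \pi_H s * \pi_H t.
    apply: hecke_ext => B T' x' xV' r'.
    by rewrite (hecke_lift_mul r') !(hecke_lift_pi _ r').
  by rewrite -IHs -IHt; apply: (rmorphM g).
Qed.

End Presentation.

Definition heckeTw (K : fieldType) (n : nat) (q : K) (w : 'S_n) :
    affine_hecke n q :=
  \prod_(i <- reduced_word w) heckeT q i.

Definition is_partition (la : seq nat) : bool :=
  sorted geq la && (0%N \notin la).

Definition is_skew_shape (la mu : seq nat) : Prop :=
  [/\ is_partition la, is_partition mu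
    & forall r, (nth 0 mu r <= nth 0 la r)%N].

(** Boxes of la/mu, as pairs (row, column), both numbered from 0 *)
Definition box (la mu : seq nat) : Type :=
  {b : 'I_(size la) * 'I_(head 0%N la) |
    (nth 0 mu b.1 <= b.2 < nth 0 la b.1)%N}.

HB.instance Definition _ la mu := Finite.on (box la mu).

Section Tableaux.
Variables (la mu : seq nat) (n : nat).
Implicit Types b : box la mu.

Definition brow b : nat := (val b).1.
Definition bcol b : nat := (val b).2.
Definition bdiag b : int := (bcol b)%:Z - (brow b)%:Z.

(** [diag_lt b b'] : b comes before b' in the numbering box_1, ..., box_n. *)
Definition diag_lt b b' : bool :=
  (bdiag b < bdiag b') || (bdiag b == bdiag b') && (brow b < brow b')%N.

Definition row_lt b b' : bool :=
  (brow b < brow b')%N || (brow b == brow b') && (bcol b < bcol b')%N.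

Definition col_lt b b' : bool :=
  (bcol b < bcol b')%N || (bcol b == bcol b') && (brow b < brow b')%N.

(** A filling L is encoded by the map sending an entry e to the box L(e) that
    contains it. *)
Definition filling := {ffun 'I_n -> box la mu}.

Definition is_standard (L : filling) : bool :=
  [&& [forall b, #|[set e | L e == b]| == 1%N],
      [forall e, forall f, (brow (L e) == brow (L f)) &&
         (bcol (L e) < bcol (L f))%N ==> (e < f)%N]
    & [forall e, forall f, (bcol (L e) == bcol (L f)) &&
         (brow (L e) < brow (L f))%N ==> (e < f)%N]].

Definition syt : Type := {L : filling | is_standard L}.

HB.instance Definition _ := SubFinite.on syt.

Definition perm_filling (w : 'S_n) (L : filling) : filling :=
  [ffun e => L ((w^-1)%g e)].

(** Different components of a skew shape lie in disjoint intervals of columns,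
    the southwest-most component being the leftmost one, so that C fills all
    columns of the shape from left to right. *)
Definition is_column_reading (C : syt) : Prop :=
  forall e f : 'I_n, (e < f)%N = col_lt (val C e) (val C f).

Definition tab_perm (C L : syt) : 'S_n :=
  odflt 1%g [pick w | perm_filling w (val C) == val L].

Definition in_snake (b b' x : box la mu) : bool :=
  (bcol x == bcol b) && (brow b <= brow x)%N ||
  (bcol x == bcol b') && (brow x <= brow b')%N.

Definition adjacent_in_row (b b' : box la mu) : bool :=
  (brow b' == brow b) && (bcol b' == (bcol b).+1).

End Tableaux.

(** The family f extended by 0 to non-standard fillings *)
Definition std_or_0 (la mu : seq nat) (n : nat) (V : zmodType)
    (f : syt la mu n -> V) (L : filling la mu n) : V :=
  oapp f 0 (insub L).

(** Representatives u of the cosets u (S_A x S_B) in S_{A u B}. Such a coset,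
    for composition of functions, is [(Sym A * Sym B) :* u] in [{perm _}]. *)
Definition min_coset_reps (n : nat) (A B : {set 'I_n}) : {set 'S_n} :=
  [set u in Sym (A :|: B) |
    [forall v in ((Sym A * Sym B) :* u)%g, (perm_len u <= perm_len v)%N]].

Section PlacedSkewShapes.
Local Open Scope complex_scope.
Variable R : realType.

Definition cexp (z : R[i]) : R[i] :=
  let: a +i* b := z in (expR a * cos b) +i* (expR a * sin b).

(** q^(2z), that is e^(z ln(q^2)) *)
Definition q2pow (q : R) (z : R[i]) : R[i] := cexp (z * (ln (q ^+ 2))%:C).

(** On [R[i]] the order [z <= z'] means that z' - z is a nonnegative real. *)
Definition is_placed_skew_shape (q : R) (la mu : seq nat)
    (c : box la mu -> R[i]) : Prop :=
  [/\ is_skew_shape la mu,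
      forall b, 0 <= complex.Im (c b) < 2 * trigo.pi / `|ln (q ^+ 2)|,
      forall b b', diag_lt b b' -> (exists m : int, c b' - c b = m%:~R) ->
        c b <= c b',
      forall b b', c b' = c b + 1 <-> bdiag b' = bdiag b + 1
    & forall b b', c b = c b' <-> bdiag b = bdiag b'].

Section Module.
Variables (q : R) (la mu : seq nat) (c : box la mu -> R[i]) (n : nat).
Local Notation H := (affine_hecke n q%:C).

Definition Tdiag (i : 'I_n.-1) (L : filling la mu n) : R[i] :=
  (q%:C - q%:C^-1) / (1 - q2pow q (c (L (ord_lo i)) - c (L (ord_hi i)))).

(** M, with the family v, is the module attached to (c, la/mu); a complex
    number a acts on M as [a%:A]. *)
Definition is_skew_module (M : lmodType H) (v : syt la mu n -> M) : Prop :=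
  [/\ bijective (fun a : {ffun syt la mu n -> R[i]} => \sum_L (a L)%:A *: v L),
      forall j L, heckeX q%:C j *: v L = (q2pow q (c (val L j)))%:A *: v L
    & forall i L, heckeT q%:C i *: v L = (Tdiag i (val L))%:A *: v L +
        (q%:C^-1 + Tdiag i (val L))%:A *:
          std_or_0 v (perm_filling (simple_tperm i) (val L))].

Definition natural_basis (M : lmodType H) (v : syt la mu n -> M)
    (C L : syt la mu n) : M :=
  heckeTw q%:C (tab_perm C L) *: v C.

End Module.
End PlacedSkewShapes.

(* Main.v *)
Require Import Defs.
From mathcomp Require Import all_boot all_order all_algebra all_fingroup.
From mathcomp Require Import reals complex.
From mathcomp Require Import sequences exp trigo zify ring.

Set Implicit Arguments.
Unset Strict Implicit.
Unset Printing Implicit Defensive.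

Import Order.TTheory GRing.Theory Num.Theory.
Local Open Scope ring_scope.
Local Open Scope complex_scope.

(** If i and i+1 lie in the same column of C, their contents differ by 1, so the
    diagonal coefficient of T_i at v_C is -q^-1 and the other one vanishes.

    Let z be the sum in (b) applied to n_C. Together with (a), multiplying the
    minimal coset representatives on the left by simple transpositions shows
    that T_m z = -q^-1 z for all m with m, m+1 in A u B. Expand z in the basis
    v_L; only tableaux L = uC with u in S_{A u B} occur, and such a u is a minimal
    representative. If s_m u is a longer one, then m lies in the left column and
    m+1 in the right column of uC, so their contents differ by a negative number,
    (T_m)_{LL} <> -q^-1, and the eigenvector equation makes the coordinate at uC
    vanish as soon as the one at s_m u C does. Descending induction on the length
    starts at the longest representative, for which uC is not standard: so z = 0.
    The longest representative is the only one with uC not standard, and it is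
    s_k u_P where P = u_P C, whence the term T_k n_P. *)

(** * Lengths and reduced words in the symmetric group *)

Section Inversions.
Variable n : nat.
Implicit Types (w : 'S_n) (i : 'I_n.-1) (x y : 'I_n) (s : seq 'I_n.-1).

Lemma simple_tpermK i : involutive (simple_tperm i).
Proof. exact: tpermK. Qed.

Lemma simple_tpermV i : (simple_tperm i)^-1%g = simple_tperm i.
Proof. exact: tpermV. Qed.

Lemma simple_tperm2 i : (simple_tperm i * simple_tperm i)%g = 1%g.
Proof. exact: tperm2. Qed.

Lemma mulg_simple_tpermK i w :
  (w * simple_tperm i * simple_tperm i)%g = w.
Proof. by rewrite -mulgA simple_tperm2 mulg1. Qed.

(** [s_i] moves each value by at most one, so the only pair whose order it can reverse is the pair
    it exchanges. *)
Lemma simple_tperm_lt i x y :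
  (x < y)%N -> (x, y) != (ord_lo i, ord_hi i) ->
  (simple_tperm i x < simple_tperm i y)%N.
Proof.
rewrite xpair_eqE -!val_eqE /= => ltxy xyN.
rewrite /simple_tperm; case: tpermP => [xE|xE|/eqP xlo /eqP xhi];
  case: tpermP => [yE|yE|/eqP ylo /eqP yhi]; subst;
  by move: ltxy xyN; rewrite -?val_eqE /=; try rewrite -val_eqE /= in xlo;
     try rewrite -val_eqE /= in xhi; try rewrite -val_eqE /= in ylo;
     try rewrite -val_eqE /= in yhi; lia.
Qed.

Definition inversions w : {set 'I_n * 'I_n} :=
  [set p : 'I_n * 'I_n | (p.1 < p.2)%N && (w p.2 < w p.1)%N].

(** Agrees with [perm_len] by [perm_lenE]; unlike a minimum over words, it can be compared through
    injections between sets of pairs. *)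
Definition ninv w := #|inversions w|.

Lemma ninvV w : ninv w^-1%g = ninv w.
Proof.
pose f (p : 'I_n * 'I_n) := (w p.2, w p.1).
have f_inj : injective f by move=> [a b] [c d] [/perm_inj-> /perm_inj->].
rewrite /ninv -(card_imset (inversions w) f_inj).
suff -> : inversions w^-1%g = f @: inversions w by [].
apply/setP => -[x y]; apply/idP/imsetP.
  rewrite inE /= => /andP[ltxy ltw].
  by exists (w^-1 y, w^-1 x)%g; rewrite ?inE /f /= ?permKV ?ltw.
move=> [[a b]]; rewrite inE /= => /andP[ltab ltw] [-> ->].
by rewrite inE /= !permK ltw.
Qed.

(** The product is [w] after [s_i] as functions, so positions are exchanged: [s_i] applied to both
    members carries the inversions of [w] to all inversions of the product except the new one at i,
    i+1. *)
Lemma ninv_simpleL i w : (w (ord_lo i) < w (ord_hi i))%N ->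
  ninv (simple_tperm i * w)%g = (ninv w).+1.
Proof.
move=> ltw; pose t := simple_tperm i.
pose f (p : 'I_n * 'I_n) := (t p.1, t p.2).
have f_inj : injective f by move=> [a b] [c d] [/perm_inj-> /perm_inj->].
rewrite /ninv -(card_imset (inversions w) f_inj).
have -> : inversions (t * w)%g = (ord_lo i, ord_hi i) |: f @: inversions w.
  apply/setP => -[x y]; rewrite !inE !permM.
  have [[-> ->]|xyN] := eqVneq (x, y) (ord_lo i, ord_hi i).
    by rewrite /= /t tpermL tpermR ltw leqnn.
  apply/andP/imsetP => [[/= ltxy lt_w]|[[a b]]].
    exists (t x, t y); last by rewrite /f /= !simple_tpermK.
    by rewrite inE /= lt_w simple_tperm_lt.
  rewrite inE /= => /andP[ltab lt_w] [-> ->]; rewrite !simple_tpermK lt_w.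
  split=> //; apply: simple_tperm_lt => //.
  by apply: contraTneq lt_w => -[-> ->]; rewrite -leqNgt ltnW.
rewrite cardsU1; suff -> : (ord_lo i, ord_hi i) \notin f @: inversions w by [].
apply/imsetP => -[[a b]]; rewrite inE /= => /andP[ltab _] [ta tb].
move: ltab; rewrite -(simple_tpermK i a) -(simple_tpermK i b) -/t -ta -tb.
by rewrite /t tpermL tpermR /=; lia.
Qed.

Lemma ninv_simpleR i w :
  ((w^-1)%g (ord_lo i) < (w^-1)%g (ord_hi i))%N ->
  ninv (w * simple_tperm i)%g = (ninv w).+1.
Proof. by move=> /ninv_simpleL; rewrite -ninvV invMg simple_tpermV invgK ninvV. Qed.

Lemma simple_desc i w : ~~ ((w^-1)%g (ord_lo i) < (w^-1)%g (ord_hi i))%N =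
  ((w^-1)%g (ord_hi i) < (w^-1)%g (ord_lo i))%N.
Proof.
rewrite -leqNgt leq_eqVlt; case: eqP => //= /val_inj /perm_inj /(congr1 val) /=.
lia.
Qed.

Lemma ninv_simpleRN i w :
  ((w^-1)%g (ord_hi i) < (w^-1)%g (ord_lo i))%N ->
  ninv w = (ninv (w * simple_tperm i)%g).+1.
Proof.
move=> lt_w; rewrite -{1}(mulg_simple_tpermK i w) ninv_simpleR //.
by rewrite invMg simple_tpermV !permM /simple_tperm tpermL tpermR.
Qed.

Definition convex (S : {set 'I_n}) := forall x y z : 'I_n,
  x \in S -> z \in S -> (x <= y <= z)%N -> y \in S.

(** Induction on the larger point; convexity keeps the point just below it in [S]. *)
Lemma incr_of_steps_in (S : {set 'I_n}) w : convex S ->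
  (forall m, ord_lo m \in S -> ord_hi m \in S -> (w (ord_lo m) < w (ord_hi m))%N) ->
  {in S &, {homo w : x y / (x < y)%N}}.
Proof.
move=> cS step x [y lt_y] xS; elim: y lt_y => [//|y IHy] lt_y yS.
have lt_y1 : (y < n.-1)%N by lia.
have yE : Ordinal lt_y = ord_hi (Ordinal lt_y1) by apply: val_inj.
have y'E : Ordinal (ltnW lt_y) = ord_lo (Ordinal lt_y1) by apply: val_inj.
rewrite /= ltnS leq_eqVlt => /orP[/eqP xy|ltxy].
  have xE : x = ord_lo (Ordinal lt_y1) by apply: val_inj.
  by rewrite yE xE step // -?xE -?yE.
have y'S : Ordinal (ltnW lt_y) \in S by apply: (cS x _ _ xS yS) => /=; lia.
by rewrite (ltn_trans (IHy (ltnW lt_y) y'S ltxy)) // y'E yE step // -?yE -?y'E.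
Qed.

(** An increasing permutation satisfies [x <= w x], and so does its inverse, which is increasing
    too. *)
Lemma perm_mono_id w : (forall x y, (x < y)%N -> (w x < w y)%N) -> w = 1%g.
Proof.
have ge_id (f : 'S_n) : (forall x y, (x < y)%N -> (f x < f y)%N) ->
    forall x, (x <= f x)%N.
  move=> f_incr [m lt_m]; elim: m lt_m => [//|m IHm] lt_m /=.
  have lt_m' := ltnW lt_m.
  by apply: leq_ltn_trans (f_incr (Ordinal lt_m') (Ordinal lt_m) _); rewrite ?IHm /=.
move=> w_incr; apply/permP => x; rewrite perm1; apply: val_inj; apply/eqP.
rewrite eqn_leq ge_id // andbT.
rewrite -{2}[x](permK w); apply: (ge_id w^-1%g) => {}x y ltxy.
rewrite ltnNge leq_eqVlt; apply/norP; split.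
  by apply/eqP => /val_inj/perm_inj xy; rewrite xy ltnn in ltxy.
by apply/negP => /w_incr; rewrite !permKV; lia.
Qed.

Lemma incr_of_steps w : (forall i, (w (ord_lo i) < w (ord_hi i))%N) ->
  forall x y, (x < y)%N -> (w x < w y)%N.
Proof.
move=> step x y; by apply: (@incr_of_steps_in setT) => // ? *; exact: in_setT.
Qed.

Lemma ninv_eq0 w : ninv w = 0%N -> w = 1%g.
Proof.
move=> w0; apply: perm_mono_id; apply: incr_of_steps => i.
have := ninv_simpleRN (i := i) (w := w^-1%g); rewrite invgK ninvV w0.
move=> H; rewrite ltnNge leq_eqVlt; apply/norP; split; last by apply/negP => /H.
by apply/eqP => /val_inj /perm_inj /(congr1 val) /=; lia.
Qed.

Lemma ninv_simpleR_le i w : (ninv (w * simple_tperm i)%g <= (ninv w).+1)%N.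
Proof.
have [lt_w|] := boolP ((w^-1)%g (ord_lo i) < (w^-1)%g (ord_hi i))%N.
  by rewrite ninv_simpleR.
rewrite simple_desc => /ninv_simpleRN ->; lia.
Qed.

Lemma ninv_word_perm s : (ninv (word_perm s) <= size s)%N.
Proof.
elim: s => [|i s IHs] /=; last exact: leq_trans (ninv_simpleR_le _ _) _.
rewrite leqn0 cards_eq0; apply/eqP/setP => -[x y]; rewrite !inE !perm1 /=.
by case: ltngtP.
Qed.

(** Sorting by adjacent exchanges: a descent of [w^-1] supplies the first letter and removes one
    inversion; without descents the permutation is the identity. *)
Lemma ninv_word w : exists2 s, word_perm s = w & size s = ninv w.
Proof.
move wE : (ninv w) => m; elim: m w wE => [|m IHm] w wE.
  by exists [::] => //; rewrite (ninv_eq0 wE).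
have [/existsP[i /ninv_simpleRN]|] :=
    boolP [exists i, (w^-1)%g (ord_hi i) < (w^-1)%g (ord_lo i)]%N.
  rewrite wE => -[/esym/IHm[s sE sz]]; exists (i :: s); last by rewrite /= sz.
  by rewrite /= sE mulg_simple_tpermK.
rewrite negb_exists => /forallP H; suff w1 : w^-1%g = 1%g.
  have := ninv_word_perm [::]; rewrite /= -w1 ninvV wE; lia.
apply: perm_mono_id; apply: incr_of_steps => i.
by apply/negPn; rewrite simple_desc H.
Qed.

Lemma perm_lenE w : perm_len w = ninv w.
Proof.
rewrite /perm_len; have [rE rmin] := reduced_wordP w.
have [s sE sz] := ninv_word w.
by apply/eqP; rewrite eqn_leq -{1}sz rmin //= -{1}rE ninv_word_perm.
Qed.

Lemma perm_len_simpleR i w :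
  ((w^-1)%g (ord_lo i) < (w^-1)%g (ord_hi i))%N ->
  perm_len (w * simple_tperm i)%g = (perm_len w).+1.
Proof. by rewrite !perm_lenE; apply: ninv_simpleR. Qed.

Lemma perm_len_simpleRN i w :
  ((w^-1)%g (ord_hi i) < (w^-1)%g (ord_lo i))%N ->
  perm_len w = (perm_len (w * simple_tperm i)%g).+1.
Proof. by rewrite !perm_lenE; apply: ninv_simpleRN. Qed.

Lemma perm_len_simpleLN i w : (w (ord_hi i) < w (ord_lo i))%N ->
  perm_len w = (perm_len (simple_tperm i * w)%g).+1.
Proof.
move=> lt_w; rewrite !perm_lenE -ninvV -[ninv (_ * _)%g]ninvV invMg simple_tpermV.
by apply: ninv_simpleRN; rewrite invgK.
Qed.

Lemma perm_len_word_le s : (perm_len (word_perm s) <= size s)%N.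
Proof. by rewrite perm_lenE ninv_word_perm. Qed.

Lemma perm_len_word w : exists2 s, word_perm s = w & size s = perm_len w.
Proof. by exists (reduced_word w) => //; exact: (reduced_wordP w).1. Qed.

(** If [i] were an ascent, stripping it would give a permutation longer than the word [s] that
    represents it. *)
Lemma reduced_word_desc i s :
  (size s < perm_len (word_perm (i :: s)))%N ->
  ((word_perm (i :: s))^-1%g (ord_hi i) < (word_perm (i :: s))^-1%g (ord_lo i))%N.
Proof.
rewrite -simple_desc => red; apply/negP => /perm_len_simpleR.
rewrite /= mulg_simple_tpermK => lenE.
by have := perm_len_word_le s; move: red => /=; lia.
Qed.

Lemma simple_tpermC i (j : 'I_n.-1) : (i.+1 < j)%N ->
  commute (simple_tperm i) (simple_tperm j).
Proof.
move=> ij; have D : forall x y : 'I_n, x != y :> nat -> x != y.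
  by move=> x y; rewrite val_eqE.
apply/commgP/conjg_fixP; rewrite /simple_tperm tpermJ.
by rewrite !tpermD //; apply: D => /=; lia.
Qed.

(** Both sides are conjugates of one simple transposition by the other, and both exchange the first
    and the last of three consecutive points. *)
Lemma simple_tperm_braid i (j : 'I_n.-1) : j = i.+1 :> nat ->
  (simple_tperm i * simple_tperm j * simple_tperm i =
   simple_tperm j * simple_tperm i * simple_tperm j)%g.
Proof.
move=> ij; have D : forall x y : 'I_n, x != y :> nat -> x != y.
  by move=> x y; rewrite val_eqE.
have loj : ord_lo j = ord_hi i by apply: val_inj.
have iV := simple_tpermV i; have jV := simple_tpermV j.
transitivity (simple_tperm j ^ simple_tperm i)%g.
  by rewrite conjgE iV mulgA.
transitivity (simple_tperm i ^ simple_tperm j)%g; last by rewrite conjgE jV mulgA.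
rewrite /simple_tperm !tpermJ loj tpermR tpermL !tpermD //; apply: D => /=; lia.
Qed.

End Inversions.

(** * Matsumoto's theorem for families satisfying the braid relations *)

Section Matsumoto.
Variables (n : nat) (A : nzRingType) (T : 'I_n.-1 -> A).
Hypothesis TC : forall i j : 'I_n.-1,
  (i.+1 < j)%N || (j.+1 < i)%N -> T i * T j = T j * T i.
Hypothesis TB : forall i j : 'I_n.-1,
  j = i.+1 :> nat -> T i * T j * T i = T j * T i * T j.

(* If two reduced words of w start with different letters i and j, both are
   descents of w, so w has a reduced word starting with i j (if s_i and s_j
   commute) or i j i, to which the relation applies. *)
Lemma matsumoto (s t : seq 'I_n.-1) :
  word_perm s = word_perm t -> size s = perm_len (word_perm s) ->
  size t = size s -> \prod_(i <- s) T i = \prod_(i <- t) T i.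
Proof.
move sz : (size s) => p; elim/ltn_ind: p s t sz => p IHp s t sz st red tz.
case: s sz st red => [|i s] /= sz st red.
  by case: t tz st => [|j t] //=; rewrite -sz.
case: t tz st => [|j t] /= tz st; first by rewrite -sz in tz.
rewrite !big_cons.
set w : 'S_n := (word_perm s * simple_tperm i)%g in st red.
have sE : word_perm s = (w * simple_tperm i)%g by rewrite /w mulg_simple_tpermK.
have tE : word_perm t = (w * simple_tperm j)%g by rewrite st mulg_simple_tpermK.
clearbody w.
have s_len : size s = (perm_len w).-1 by lia.
have t_len : size t = (perm_len w).-1 by lia.
have desc m u : word_perm u = (w * simple_tperm m)%g ->
    size u = (perm_len w).-1 -> (0 < perm_len w)%N ->
    (w^-1%g (ord_hi m) < w^-1%g (ord_lo m))%N.
  move=> uE uz w0; rewrite -simple_desc; apply/negP => /perm_len_simpleR.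
  by have := perm_len_word_le u; rewrite uE; lia.
have w0 : (0 < perm_len w)%N by lia.
have IH (u u' : seq _) : word_perm u = word_perm u' ->
    size u = perm_len (word_perm u) -> (size u < perm_len w)%N ->
    size u' = size u -> \prod_(i <- u) T i = \prod_(i <- u') T i.
  by move=> uE ured lt_u uz; apply: (IHp (size u)) => //; rewrite red.
clear IHp sz tz red st.
have di := desc i s sE s_len w0; have dj := desc j t tE t_len w0.
have ls := perm_len_simpleRN di; have lt := perm_len_simpleRN dj.
have [ij|ij] := eqVneq i j.
  rewrite ij; congr (_ * _); apply: IH; rewrite ?sE ?tE ?s_len ?t_len ?ls ?ij //.
wlog lt_ij : i j s t sE tE s_len t_len di dj ls lt ij / (i < j)%N.
  move=> H; case: (ltngtP i j) => [|lt_ji|/val_inj/eqP]; last by rewrite (negPf ij).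
    exact: H.
  by apply/esym/(H j i t s) => //; rewrite eq_sym.
have [ij1|ij1] := eqVneq (j : nat) i.+1.
  have hlo : ord_hi i = ord_lo j by apply: val_inj.
  pose w1 : 'S_n := (w * simple_tperm i)%g.
  pose w2 : 'S_n := (w1 * simple_tperm j)%g.
  (* The values of [w^-1] at the three consecutive points decrease, so stripping i leaves a descent
     at j, and stripping j next leaves one at i. *)
  have d1 : (w1^-1%g (ord_hi j) < w1^-1%g (ord_lo j))%N.
    rewrite /w1 invMg simple_tpermV !permM /simple_tperm -hlo tpermR tpermD.
    - by apply: ltn_trans di; rewrite hlo.
    - by rewrite -val_eqE /=; lia.
    - by rewrite -val_eqE /=; lia.
  have d2 : (w2^-1%g (ord_hi i) < w2^-1%g (ord_lo i))%N.
    rewrite /w2 /w1 !invMg !simple_tpermV !permM /simple_tperm -hlo tpermL.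
    rewrite [tperm (ord_hi i) _ (ord_lo i)]tpermD ?tpermL; first last.
    - by rewrite -val_eqE /=; lia.
    - by rewrite -val_eqE /=; lia.
    - rewrite tpermD ?hlo //.
      by rewrite -val_eqE /=; lia.
      by rewrite -val_eqE /=; lia.
  have l1 := perm_len_simpleRN d1; have l2 := perm_len_simpleRN d2.
  (* [u] is a reduced word of what is left. Then i j i u and j i j u are both reduced words of [w],
     and [s] and [t] are compared with their tails. *)
  have [u uE uz] := perm_len_word (w2 * simple_tperm i)%g.
  rewrite -/w1 in ls l1; rewrite -/w2 in l1 l2.
  have -> : \prod_(m <- s) T m = \prod_(m <- j :: i :: u) T m.
    apply: IH => /=; rewrite ?uE ?mulg_simple_tpermK //= ?sE ?uz -/w1; try lia.
  have -> : \prod_(m <- t) T m = \prod_(m <- i :: j :: u) T m.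
    apply: IH => /=; rewrite ?uE ?tE ?uz; try lia.
    have -> : (w2 * simple_tperm i)%g =
        (w * (simple_tperm i * simple_tperm j * simple_tperm i))%g.
      by rewrite /w2 /w1 !mulgA.
    by rewrite simple_tperm_braid // !mulgA !mulg_simple_tpermK.
  by rewrite !big_cons !mulrA TB.
pose w1 : 'S_n := (w * simple_tperm i)%g.
have d1 : (w1^-1%g (ord_hi j) < w1^-1%g (ord_lo j))%N.
  rewrite /w1 invMg simple_tpermV !permM /simple_tperm.
  by rewrite !tpermD // -val_eqE /=; lia.
have l1 := perm_len_simpleRN d1; rewrite -/w1 in ls l1.
have [u uE uz] := perm_len_word (w1 * simple_tperm j)%g.
have -> : \prod_(m <- s) T m = \prod_(m <- j :: u) T m.
  by apply: IH => /=; rewrite ?uE ?mulg_simple_tpermK ?sE ?uz -/w1; try lia.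
have -> : \prod_(m <- t) T m = \prod_(m <- i :: u) T m.
  apply: IH => /=; rewrite ?uE ?tE ?uz; try lia.
  rewrite /w1 -!mulgA; congr (w * _)%g.
  by rewrite -simple_tpermC ?simple_tpermK ?mulgA ?simple_tperm2 ?mul1g //; lia.
by rewrite !big_cons !mulrA TC //; lia.
Qed.

End Matsumoto.

(** * The elements [T_w] of the affine Hecke algebra *)

Section HeckeTw.
Variables (K : fieldType) (n : nat) (q : K).
Implicit Types (w : 'S_n) (i : 'I_n.-1) (s : seq 'I_n.-1).

(** The definition of [heckeTw] picks one reduced word; by Matsumoto's theorem any other gives the
    same product. *)
Lemma heckeTw_word s : size s = perm_len (word_perm s) ->
  heckeTw q (word_perm s) = \prod_(i <- s) heckeT q i.
Proof.
have [TC TB _ _ _] := affine_heckeP n q; move=> red.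
have [rE _] := reduced_wordP (word_perm s).
by apply: (matsumoto TC TB); rewrite ?rE.
Qed.

Lemma heckeTw1 : heckeTw q (1 : 'S_n) = 1.
Proof.
rewrite (@heckeTw_word [::]) ?big_nil //=.
by have := perm_len_word_le (Nil 'I_n.-1); rewrite /= leqn0 => /eqP.
Qed.

(** As a composition of functions the permutation is [s_i] after [w], which puts the generator on
    the left; the hypothesis says that the length goes up. *)
Lemma heckeTw_simpleR i w :
  ((w^-1)%g (ord_lo i) < (w^-1)%g (ord_hi i))%N ->
  heckeTw q (w * simple_tperm i)%g = heckeT q i * heckeTw q w.
Proof.
move=> /perm_len_simpleR; have [s <- sz] := perm_len_word w => lenE.
have := @heckeTw_word (i :: s); rewrite /= lenE sz => -> //.
by rewrite (heckeTw_word sz) big_cons.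
Qed.

Lemma heckeTw_simpleL i w : (w (ord_lo i) < w (ord_hi i))%N ->
  heckeTw q (simple_tperm i * w)%g = heckeTw q w * heckeT q i.
Proof.
move=> lt_w; have := @perm_len_simpleLN _ i (simple_tperm i * w)%g.
rewrite !permM /simple_tperm tpermL tpermR mulgA tperm2 mul1g => /(_ lt_w).
have [s <- sz] := perm_len_word w => lenE.
have wE : word_perm (rcons s i) = (simple_tperm i * word_perm s)%g.
  by rewrite -cats1 word_perm_cat /= mul1g.
rewrite (heckeTw_word sz) -[tperm _ _]/(simple_tperm i) -wE heckeTw_word.
  by rewrite -cats1 big_cat big_seq1.
by rewrite wE lenE size_rcons sz.
Qed.

End HeckeTw.

(** * Minimal coset representatives *)

Section ConvexSets.
Variable n : nat.
Implicit Types (w u : 'S_n) (m : 'I_n.-1) (S : {set 'I_n}).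

Lemma Sym_simple_tperm S m : ord_lo m \in S -> ord_hi m \in S ->
  simple_tperm m \in Sym S.
Proof.
move=> loS hiS; rewrite inE; apply/subsetP => x; rewrite !inE.
by rewrite /simple_tperm; case: tpermP => [->|->|] //; rewrite eqxx.
Qed.

Lemma SymP S w : reflect (forall x, x \notin S -> w x = x) (w \in Sym S).
Proof.
rewrite inE; apply: (iffP idP) => [wS x|H]; first exact: out_perm wS.
apply/subsetP => x; rewrite !inE; apply: contraR => /H ->; exact: eqxx.
Qed.

Lemma Sym_closed S w x : w \in Sym S -> (w x \in S) = (x \in S).
Proof. by rewrite inE => /perm_closed. Qed.

Lemma Sym_closedV S w x : w \in Sym S -> ((w^-1)%g x \in S) = (x \in S).
Proof. by rewrite -{2}[x](permKV w) => /Sym_closed ->. Qed.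

(** [w^-1] fixes every point outside [S], so two such points give no descent, and a single one would
    lie between two points of [S]. *)
Lemma Sym_desc S w m : convex S -> w \in Sym S ->
  ((w^-1)%g (ord_hi m) < (w^-1)%g (ord_lo m))%N ->
  ord_lo m \in S /\ ord_hi m \in S.
Proof.
move=> cS; rewrite -groupV => wS; set v := (w^-1)%g in wS *.
have fixv := SymP S v wS => lt_v.
have [loS|loS] := boolP (ord_lo m \in S);
  have [hiS|hiS] := boolP (ord_hi m \in S) => //.
- have := fixv _ hiS => vE; rewrite vE in lt_v; case/negP: hiS.
  apply: (cS (ord_lo m) _ (v (ord_lo m))); rewrite ?(Sym_closed _ wS) //=.
  by move: lt_v => /=; lia.
- have := fixv _ loS => vE; rewrite vE in lt_v; case/negP: loS.
  apply: (cS (v (ord_hi m)) _ (ord_hi m)); rewrite ?(Sym_closed _ wS) //=.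
  by move: lt_v => /=; lia.
- by move: lt_v; rewrite !fixv //=; lia.
Qed.

(** The first letter of a reduced word is a descent, so [Sym_desc] places it in [S]; stripping it
    leaves a permutation of [S], and the argument repeats. *)
Lemma Sym_reduced_letters S s : convex S -> size s = perm_len (word_perm s) ->
  word_perm s \in Sym S ->
  forall m, m \in s -> ord_lo m \in S /\ ord_hi m \in S.
Proof.
move=> cS; elim: s => [//|m s IHs] red wS.
have d : ((word_perm (m :: s))^-1%g (ord_hi m) <
          (word_perm (m :: s))^-1%g (ord_lo m))%N.
  by apply: reduced_word_desc; rewrite -red.
have [loS hiS] := Sym_desc cS wS d.
move=> m'; rewrite inE => /orP[/eqP-> //|]; apply: IHs.
  by have := perm_len_simpleRN d; rewrite -red /= mulg_simple_tpermK => -[].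
rewrite -(mulg_simple_tpermK m (word_perm s)); apply: groupM => //.
exact: Sym_simple_tperm.
Qed.

(** [w] after [u^-1] is increasing on [S] and fixes the rest; by convexity it is increasing
    everywhere, hence the identity. *)
Lemma Sym_order_inj S u w : convex S -> u \in Sym S -> w \in Sym S ->
  {in S &, forall x y : 'I_n, (u x < u y)%N -> (w x < w y)%N} -> u = w.
Proof.
move=> cS uS wS uw; suff vE : (u^-1 * w)%g = 1%g.
  by move/eqP: vE; rewrite -eq_invg_mul invgK => /eqP.
have vS : (u^-1 * w)%g \in Sym S by rewrite groupM ?groupV.
have vcl x := Sym_closed x vS.
apply: perm_mono_id => x y ltxy.
have [xS|xS] := boolP (x \in S); have [yS|yS] := boolP (y \in S).
- by rewrite !permM uw ?(Sym_closedV _ uS) // !permKV.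
- rewrite (SymP _ _ vS _ yS) ltnNge; apply: contra yS => le_v.
  by apply: (cS x _ ((u^-1 * w)%g x)); rewrite ?vcl // le_v ltnW.
- rewrite (SymP _ _ vS _ xS) ltnNge; apply: contra xS => le_v.
  by apply: (cS ((u^-1 * w)%g y) _ y); rewrite ?vcl // le_v ltnW.
- by rewrite !(SymP _ _ vS).
Qed.

(** A point outside a convex set lies on one side of the whole set, and [u] preserves the set. *)
Lemma Sym_lt_outside S u x y : convex S -> u \in Sym S ->
  ~~ ((x \in S) && (y \in S)) -> (x < y)%N -> (u x < u y)%N.
Proof.
move=> cS uS; have [xS /= yS|xS _ ltxy] := boolP (x \in S).
  move=> ltxy; rewrite (SymP _ _ uS _ yS) ltnNge; apply: contra yS => le_u.
  by apply: (cS x _ (u x)) => //; rewrite ?Sym_closed // le_u ltnW.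
have [yS|yS] := boolP (y \in S); last by rewrite !(SymP _ _ uS).
rewrite (SymP _ _ uS _ xS) ltnNge; apply: contra xS => le_u.
by apply: (cS (u y) _ y) => //; rewrite ?Sym_closed // le_u ltnW.
Qed.

Lemma incr_mul_simple S u m : {in S &, {homo u : x y / (x < y)%N}} ->
  ~~ (((u^-1)%g (ord_lo m) \in S) && ((u^-1)%g (ord_hi m) \in S)) ->
  {in S &, {homo (u * simple_tperm m)%g : x y / (x < y)%N}}.
Proof.
move=> u_incr nS x y xS yS ltxy; rewrite !permM simple_tperm_lt ?u_incr //.
by apply: contra nS => /eqP[<- <-]; rewrite !permK xS.
Qed.

(** The positions of the values m and m+1 are consecutive, since a position between them lies in [S]
    and would need a value strictly in between. Conjugation by [u] then turns one exchange into the
    other. *)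
Lemma incr_same_block S u m : convex S -> {in S &, {homo u : x y / (x < y)%N}} ->
  (u^-1)%g (ord_lo m) \in S -> (u^-1)%g (ord_hi m) \in S ->
  exists a : 'I_n.-1, [/\ ord_lo a \in S, ord_hi a \in S,
    u (ord_lo a) = ord_lo m, u (ord_hi a) = ord_hi m &
    (u * simple_tperm m = simple_tperm a * u)%g].
Proof.
move=> cS u_incr; set x := (u^-1)%g _; set y := (u^-1)%g _ => xS yS.
have ux : u x = ord_lo m by rewrite permKV.
have uy : u y = ord_hi m by rewrite permKV.
have ltxy : (x < y)%N.
  rewrite ltnNge leq_eqVlt; apply/norP; split.
    by apply/eqP => /val_inj/perm_inj/(congr1 val) /=; lia.
  by apply/negP => /(u_incr _ _ yS xS); rewrite ux uy /=; lia.
have lt_x : (x < n.-1)%N by have := ltn_ord y; lia.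
have xE : ord_lo (Ordinal lt_x) = x by apply: val_inj.
have yE : ord_hi (Ordinal lt_x) = y.
  apply: val_inj => /=; apply/eqP; rewrite eqn_leq ltxy leqNgt; apply/negP => lt_y.
  set z := ord_hi (Ordinal lt_x).
  have zS : z \in S by apply: (cS x _ y) => //=; lia.
  have := u_incr x z xS zS (leqnn _); have := u_incr z y zS yS lt_y.
  by rewrite ux uy /=; lia.
exists (Ordinal lt_x); rewrite xE yE; split => //.
have := tpermJ x y u; rewrite conjgE ux uy -/(simple_tperm m) => <-.
by rewrite !mulgA mulgV mul1g /simple_tperm xE yE.
Qed.

Section Cosets.
Variables A B : {set 'I_n}.
Hypotheses (cA : convex A) (cB : convex B) (cAB : convex (A :|: B)).
Hypothesis ltAB : {in A & B, forall x y : 'I_n, (x < y)%N}.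

Lemma not_in_both x : ~~ ((x \in A) && (x \in B)).
Proof. by apply/negP => /andP[xA xB]; have := ltAB xA xB; rewrite ltnn. Qed.

(** An increasing block contains no inversion and points outside [A :|: B] are fixed. In particular
    the length is at most [#|A| * #|B|]. *)
Lemma inversions_blocks u : u \in Sym (A :|: B) ->
  {in A &, {homo u : x y / (x < y)%N}} -> {in B &, {homo u : x y / (x < y)%N}} ->
  inversions u \subset setX A B.
Proof.
move=> uAB uA uB; apply/subsetP => -[x y]; rewrite !inE /= => /andP[ltxy ltu].
have [xS|xS] := boolP (x \in A :|: B); have [yS|yS] := boolP (y \in A :|: B).
- move: xS yS; rewrite !inE => /orP[xA|xB] /orP[yA|yB]; rewrite ?xA ?yB //.
  + by have := uA _ _ xA yA ltxy; lia.
  + by have := ltAB yA xB; lia.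
  + by have := uB _ _ xB yB ltxy; lia.
- case/negP: (yS); apply: (cAB xS (z := u x)); rewrite ?Sym_closed //.
  by rewrite ltnW //= ltnW // -{1}(SymP _ _ uAB _ yS).
- case/negP: (xS); apply: (cAB (x := u y) (z := y)); rewrite ?Sym_closed //.
  by rewrite -{1}(SymP _ _ uAB _ xS) ltnW // ltnW.
- by move: ltu; rewrite !(SymP _ _ uAB) //; lia.
Qed.

(** Minimal representatives are the shuffles: a descent inside a block could be removed by a simple
    transposition of that block without leaving the coset, and conversely every element of the coset
    of a shuffle has at least as many inversions as the shuffle. *)
Lemma min_coset_repsP u : reflect
  [/\ u \in Sym (A :|: B), {in A &, {homo u : x y / (x < y)%N}}
    & {in B &, {homo u : x y / (x < y)%N}}]
  (u \in min_coset_reps A B).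
Proof.
rewrite [X in reflect _ X]inE; apply: (iffP andP).
  move=> [uAB /forallP umin].
  have step m : simple_tperm m \in (Sym A * Sym B)%g ->
      (u (ord_lo m) < u (ord_hi m))%N.
    move=> mAB; rewrite ltnNge leq_eqVlt; apply/norP; split.
      by apply/eqP => /val_inj/perm_inj/(congr1 val) /=; lia.
    apply/negP => /perm_len_simpleLN lenE.
    have /implyP := umin (simple_tperm m * u)%g.
    by rewrite mem_rcoset mulgK mAB lenE ltnn => /(_ isT).
  split=> //; apply: incr_of_steps_in => // m loS hiS; apply: step.
    by rewrite -[simple_tperm m]mulg1 mem_mulg ?Sym_simple_tperm ?group1.
  by rewrite -[simple_tperm m]mul1g mem_mulg ?Sym_simple_tperm ?group1.
move=> [uAB uA uB]; split=> //; apply/forallP => v; apply/implyP; rewrite mem_rcoset.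
set g := (v * u^-1)%g => /mulsgP[s t sA tB gE].
have -> : v = (g * u)%g by rewrite mulgKV.
clearbody g.
have stable (S S' : {set 'I_n}) (p : 'S_n) x :
    (forall x, ~~ ((x \in S) && (x \in S'))) ->
    p \in Sym S -> (p x \in S') = (x \in S').
  move=> dSS pS; have [xS|xS] := boolP (x \in S); last by rewrite (SymP _ _ pS).
  have := dSS x; have := dSS (p x); rewrite (Sym_closed _ pS) xS /=.
  by move=> /negPf-> /negPf->.
have gA x : (g x \in A) = (x \in A).
  rewrite gE permM (stable B) ?(Sym_closed _ sA) // => y.
  by rewrite andbC not_in_both.
have gB x : (g x \in B) = (x \in B).
  by rewrite gE permM (Sym_closed _ tB) (stable A) //; exact: not_in_both.
rewrite !perm_lenE.
(* Inversions of [u] pair [A] with [B] and [g^-1] preserves both blocks, so [f] injects them into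
   the inversions of [g * u]. *)
pose f (p : 'I_n * 'I_n) := ((g^-1)%g p.1, (g^-1)%g p.2).
have f_inj : injective f by move=> [a b] [c d] [/perm_inj-> /perm_inj->].
rewrite /ninv -(card_imset (inversions u) f_inj); apply: subset_leq_card.
apply/subsetP => _ /imsetP[[x y] xy ->].
have := subsetP (inversions_blocks uAB uA uB) _ xy.
rewrite inE /= => /andP[xA yB]; move: xy; rewrite !inE /= => /andP[_ ltu].
rewrite !permM !permKV ltu andbT; apply: ltAB.
  by rewrite -gA permKV.
by rewrite -gB permKV.
Qed.

(** The values m and m+1 sit in different blocks, so exchanging them keeps each block increasing.
    Here the length goes up; in the reverse case below it goes down. *)
Lemma min_coset_reps_step u m : u \in min_coset_reps A B ->
  (u^-1)%g (ord_lo m) \in A -> (u^-1)%g (ord_hi m) \in B ->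
  (u * simple_tperm m)%g \in min_coset_reps A B.
Proof.
move=> /min_coset_repsP[uAB uA uB] xA yB.
have loAB : ord_lo m \in A :|: B by rewrite -(Sym_closedV _ uAB) inE xA.
have hiAB : ord_hi m \in A :|: B by rewrite -(Sym_closedV _ uAB) inE yB orbT.
apply/min_coset_repsP; split.
- by rewrite groupM // Sym_simple_tperm.
- by apply: incr_mul_simple => //; have := not_in_both ((u^-1)%g (ord_hi m));
    rewrite yB andbT => /negPf->; rewrite andbF.
- by apply: incr_mul_simple => //; have := not_in_both ((u^-1)%g (ord_lo m));
    rewrite xA /= => /negPf->.
Qed.

Lemma min_coset_reps_stepV u m : u \in min_coset_reps A B ->
  (u^-1)%g (ord_lo m) \in B -> (u^-1)%g (ord_hi m) \in A ->
  (u * simple_tperm m)%g \in min_coset_reps A B.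
Proof.
move=> /min_coset_repsP[uAB uA uB] xB yA.
have loAB : ord_lo m \in A :|: B by rewrite -(Sym_closedV _ uAB) inE xB orbT.
have hiAB : ord_hi m \in A :|: B by rewrite -(Sym_closedV _ uAB) inE yA.
apply/min_coset_repsP; split.
- by rewrite groupM // Sym_simple_tperm.
- by apply: incr_mul_simple => //; have := not_in_both ((u^-1)%g (ord_lo m));
    rewrite xB andbT => /negPf->.
- by apply: incr_mul_simple => //; have := not_in_both ((u^-1)%g (ord_hi m));
    rewrite yA /= => /negPf->; rewrite andbF.
Qed.

(** If a value on [A] were below a value on [B], then walking up through the values in between, all
    taken on [A :|: B], would cross from [A] to [B] at some m, m+1. *)
Lemma min_coset_reps_max u : u \in min_coset_reps A B ->
  (forall m, (u^-1)%g (ord_lo m) \in A -> (u^-1)%g (ord_hi m) \in B -> False) ->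
  {in A & B, forall x y : 'I_n, (u y < u x)%N}.
Proof.
move=> /min_coset_repsP[uAB uA uB] umax x y xA yB.
rewrite ltnNge; apply/negP => lexy.
have uxS : u x \in A :|: B by rewrite (Sym_closed _ uAB) inE xA.
have uyS : u y \in A :|: B by rewrite (Sym_closed _ uAB) inE yB orbT.
suff H : forall t (lt_t : (t < n)%N), (u x <= t <= u y)%N ->
    (u^-1)%g (Ordinal lt_t) \in A.
  have := H (u y) (ltn_ord _); rewrite lexy leqnn => /(_ isT).
  rewrite (_ : Ordinal _ = u y) ?permK; last exact: val_inj.
  by move=> yA; have := not_in_both y; rewrite yA yB.
elim=> [|t IHt] lt_t le_t.
  by rewrite (_ : Ordinal _ = u x) ?permK //; apply: val_inj => /=; lia.
have [uxt|uxt] := eqVneq (u x : nat) t.+1.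
  by rewrite (_ : Ordinal _ = u x) ?permK //; apply: val_inj.
have lt_t1 : (t < n.-1)%N by lia.
have tE : Ordinal lt_t = ord_hi (Ordinal lt_t1) by apply: val_inj.
have t'E : Ordinal (ltnW lt_t) = ord_lo (Ordinal lt_t1) by apply: val_inj.
have tA : (u^-1)%g (Ordinal (ltnW lt_t)) \in A by apply: IHt; lia.
have : (u^-1)%g (Ordinal lt_t) \in A :|: B.
  by rewrite (Sym_closedV _ uAB); apply: (cAB uxS uyS).
rewrite inE => /orP[//|tB]; case: (umax (Ordinal lt_t1)); by rewrite -?tE -?t'E.
Qed.

(** Both order the points of [A :|: B] alike: increasing on each block, with the values on [B] below
    those on [A]. *)
Lemma min_coset_reps_max_uniq u w :
  u \in min_coset_reps A B -> w \in min_coset_reps A B ->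
  {in A & B, forall x y : 'I_n, (u y < u x)%N} ->
  {in A & B, forall x y : 'I_n, (w y < w x)%N} ->
  u = w.
Proof.
move=> /min_coset_repsP[uAB uA uB] /min_coset_repsP[wAB wA wB] umax wmax.
apply: (Sym_order_inj cAB uAB wAB) => x y; rewrite !inE.
have incr S : {in S &, {homo u : x y / (x < y)%N}} ->
    {in S &, {homo w : x y / (x < y)%N}} ->
    x \in S -> y \in S -> (u x < u y)%N -> (w x < w y)%N.
  move=> uS wS xS yS ltu; apply: wS => //; rewrite ltnNge leq_eqVlt.
  apply/norP; split; first by apply/eqP => /val_inj xy; rewrite xy ltnn in ltu.
  by apply/negP => /(uS _ _ yS xS); lia.
move=> /orP[xA|xB] /orP[yA|yB].
- exact: incr uA wA xA yA.
- by have := umax _ _ xA yB; lia.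
- by rewrite wmax.
- exact: incr uB wB xB yB.
Qed.

Lemma perm_len_max u : u \in min_coset_reps A B ->
  {in A & B, forall x y : 'I_n, (u y < u x)%N} -> perm_len u = (#|A| * #|B|)%N.
Proof.
move=> /min_coset_repsP[uAB uA uB] umax; rewrite perm_lenE -cardsX /ninv.
congr #|pred_of_set _|; apply/eqP; rewrite eqEsubset inversions_blocks //.
by apply/subsetP => -[x y]; rewrite !inE /= => /andP[xA yB]; rewrite ltAB ?umax.
Qed.

End Cosets.
End ConvexSets.

(** * Standard tableaux and snakes *)

Lemma is_partition_nth la r r' : is_partition la -> (r <= r')%N ->
  (nth 0 la r' <= nth 0 la r)%N.
Proof.
move=> /andP[la_sorted _] le_r.
have [le_la|lt_la] := leqP (size la) r'; first by rewrite nth_default.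
apply: (@sorted_leq_nth _ geq) => //; last by rewrite inE; lia.
- by move=> a b c /= ab bc; apply: leq_trans bc ab.
- exact: leqnn.
Qed.

Section TableauFacts.
Variables (la mu : seq nat) (n : nat).
Implicit Types (x y : box la mu) (L C : syt la mu n).
Implicit Types (w : 'S_n) (F : filling la mu n).

Lemma box_inj x y : brow x = brow y -> bcol x = bcol y -> x = y.
Proof.
move=> rE cE; apply: val_inj; apply/eqP.
by rewrite [val x]surjective_pairing [val y]surjective_pairing xpair_eqE
   -!val_eqE /= -/(brow x) -/(brow y) -/(bcol x) -/(bcol y) rE cE !eqxx.
Qed.

(** Row lengths of a partition weakly decrease, so the left bound in row [r] comes from [x] and the
    right bound from [y]. *)
Lemma box_between x y r : is_skew_shape la mu -> bcol x = bcol y ->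
  (brow x <= r <= brow y)%N -> exists2 z : box la mu, brow z = r & bcol z = bcol x.
Proof.
move=> [pla pmu _]; case: x => -[rx cx] /= xP; case: y => -[ry cy] /= yP.
rewrite /bcol /brow /= in xP yP * => cE /andP[le_x le_y].
have lt_r : (r < size la)%N by have := ltn_ord ry; lia.
have zP : (nth 0 mu (Ordinal lt_r) <= cx < nth 0 la (Ordinal lt_r))%N.
  have /= := is_partition_nth pmu le_x; have /= := is_partition_nth pla le_y.
  by lia.
by exists (exist _ (Ordinal lt_r, cx) zP).
Qed.

Lemma syt_bij L : bijective (val L).
Proof.
have /and3P[/forallP H _ _] := valP L.
have ex x : exists e, val L e == x.
  have : (0 < #|[set e | val L e == x]|)%N by rewrite (eqP (H x)).
  by case/card_gt0P => e; rewrite inE; exists e.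
exists (fun x => xchoose (ex x)) => [e|x]; last exact/eqP/(xchooseP (ex x)).
have /cards1P[f fE] := H (val L e).
have : e \in [set f | val L f == val L e] by rewrite inE.
have : xchoose (ex (val L e)) \in [set f | val L f == val L e].
  by rewrite inE; exact: (xchooseP (ex (val L e))).
by rewrite fE !inE => /eqP-> /eqP->.
Qed.

Lemma syt_row L e f : brow (val L e) = brow (val L f) ->
  (bcol (val L e) < bcol (val L f))%N -> (e < f)%N.
Proof.
have /and3P[_ /forallP H _] := valP L => rE lt_c.
by have /forallP/(_ f)/implyP := H e; apply; rewrite rE eqxx.
Qed.

Lemma syt_col L e f : bcol (val L e) = bcol (val L f) ->
  (brow (val L e) < brow (val L f))%N -> (e < f)%N.
Proof.
have /and3P[_ _ /forallP H] := valP L => rE lt_c.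
by have /forallP/(_ f)/implyP := H e; apply; rewrite rE eqxx.
Qed.

(** Otherwise a box strictly between the two in their column would hold an entry strictly between i
    and i+1. *)
Lemma column_reading_next C i : is_skew_shape la mu -> is_column_reading C ->
  bcol (val C (ord_lo i)) = bcol (val C (ord_hi i)) ->
  brow (val C (ord_hi i)) = (brow (val C (ord_lo i))).+1.
Proof.
move=> sk colC cE; have := colC (ord_lo i) (ord_hi i).
rewrite /col_lt cE ltnn eqxx /= leqnn => /esym lt_r.
apply/eqP; rewrite eqn_leq lt_r andbT leqNgt; apply/negP => lt_r'.
have [|z zr zc] := @box_between _ _ (brow (val C (ord_lo i))).+1 sk cE.
  by rewrite leqnSn ltnW.
have [g _ gK] := syt_bij C.
have := colC (ord_lo i) (g z); have := colC (g z) (ord_hi i).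
rewrite /col_lt gK zr zc cE ltnn eqxx lt_r' /= leqnn; lia.
Qed.

Lemma perm_fillingM u w F :
  perm_filling (u * w)%g F = perm_filling w (perm_filling u F).
Proof. by apply/ffunP => e; rewrite !ffunE invMg permM. Qed.

Lemma perm_filling_permE w F e : perm_filling w F (w e) = F e.
Proof. by rewrite ffunE permK. Qed.

Lemma perm_filling_inj C : injective (fun w => perm_filling w (val C)).
Proof.
move=> u w /ffunP uw; apply: invg_inj; apply/permP => e.
by have := uw e; rewrite !ffunE; apply: (bij_inj (syt_bij C)).
Qed.

(** Sending each entry of [C] to the entry of [L] in the same box is a permutation with this
    property, so the default [1] in [tab_perm] is never a fallback. *)
Lemma tab_permP C L : perm_filling (tab_perm C L) (val C) = val L.
Proof.
rewrite /tab_perm; case: pickP => [w /eqP //|/= noP].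
have [g gK Kg] := syt_bij L.
have f_inj : injective (fun e => g (val C e)).
  by move=> e f /(can_inj Kg)/(bij_inj (syt_bij C)).
have /eqP[] := noP (perm f_inj); apply/ffunP => e.
by rewrite -{1}[e](permKV (perm f_inj)) perm_filling_permE
  -{2}[e](permKV (perm f_inj)) [in RHS]permE Kg.
Qed.

Lemma tab_perm_eq C L w : perm_filling w (val C) = val L -> tab_perm C L = w.
Proof. by move=> wE; apply: (@perm_filling_inj C); rewrite tab_permP. Qed.

Lemma tab_perm_id C : tab_perm C C = 1%g.
Proof. by apply: tab_perm_eq; apply/ffunP => e; rewrite ffunE invg1 perm1. Qed.

Lemma perm_filling_bij C w : bijective (perm_filling w (val C)).
Proof.
have [g gK Kg] := syt_bij C; exists (fun x => w (g x)) => [e|x].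
  by rewrite ffunE gK permKV.
by rewrite perm_filling_permE Kg.
Qed.

(** Any rearrangement of [C] still fills each box once, so only the row and column inequalities
    remain, read at the entries of [C]. *)
Lemma perm_filling_standardP C w :
  reflect (forall e f : 'I_n, brow (val C e) = brow (val C f) /\
               (bcol (val C e) < bcol (val C f))%N \/
             bcol (val C e) = bcol (val C f) /\
               (brow (val C e) < brow (val C f))%N -> (w e < w f)%N)
    (is_standard (perm_filling w (val C))).
Proof.
apply: (iffP and3P) => [[_ /forallP rowP /forallP colP] e f|H].
  case=> [] [E lt_ef].
    have /forallP/(_ (w f))/implyP := rowP (w e).
    by rewrite !perm_filling_permE E eqxx; apply.
  have /forallP/(_ (w f))/implyP := colP (w e).
  by rewrite !perm_filling_permE E eqxx; apply.
have [g gK Kg] := perm_filling_bij C w; split.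
- apply/forallP => x; apply/cards1P; exists (g x); apply/setP => e.
  by rewrite !inE; apply/eqP/eqP => [<-|->]; rewrite ?gK ?Kg.
- apply/forallP => e; apply/forallP => f; apply/implyP.
  rewrite !ffunE => /andP[/eqP E lt_ef]; rewrite -[e](permKV w) -[f](permKV w).
  by apply: H; left.
- apply/forallP => e; apply/forallP => f; apply/implyP.
  rewrite !ffunE => /andP[/eqP E lt_ef]; rewrite -[e](permKV w) -[f](permKV w).
  by apply: H; right.
Qed.

Lemma std_or_0_val (V : zmodType) (f : syt la mu n -> V) L :
  std_or_0 f (val L) = f L.
Proof. by rewrite /std_or_0 valK. Qed.

Lemma std_or_0_nonstd (V : zmodType) (f : syt la mu n -> V) F :
  ~~ is_standard F -> std_or_0 f F = 0.
Proof. by move=> FN; rewrite /std_or_0 insubN. Qed.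

(** A view for case analysis on [std_or_0]: it produces the tableau behind a standard filling. *)
Variant std_spec F : bool -> Prop :=
  | StdSpec L of val L = F : std_spec F true
  | NonStdSpec of ~~ is_standard F : std_spec F false.

Lemma stdP F : std_spec F (is_standard F).
Proof.
have [Fs|Fs] := boolP (is_standard F); last exact: NonStdSpec.
exact: (@StdSpec _ (Sub F Fs)).
Qed.

End TableauFacts.

Lemma interval_convex n (a b : nat) : convex [set e : 'I_n | (a <= e <= b)%N].
Proof. by move=> x y z; rewrite !inE; lia. Qed.

Lemma interval_ltn n (a b d : nat) :
  {in [set e : 'I_n | (a <= e <= b)%N] & [set e : 'I_n | (b < e <= d)%N],
    forall x y : 'I_n, (x < y)%N}.
Proof. by move=> x y; rewrite !inE; lia. Qed.

Lemma card_interval n (a b : nat) : (b <= n)%N ->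
  #|[set e : 'I_n | (a <= e < b)%N]| = (b - a)%N.
Proof.
move=> le_b; rewrite -[RHS]mul1n -[RHS]mulnC -sum_nat_const_nat.
rewrite (big_nat_widen _ _ n) // (big_nat_widenl _ 0) // big_mkord cardsE -sum1_card.
by apply: eq_bigl => e; rewrite -topredE /= andbC.
Qed.

(** For [a] and [b] the sizes of the two columns of the snake, this makes the exponent of the
    longest representative vanish. *)
Lemma bin2_add (a b : nat) : 'C(a + b, 2) = ('C(a, 2) + 'C(b, 2) + a * b)%N.
Proof.
elim: b => [|b IHb]; first by rewrite addn0 muln0 !addn0.
by rewrite addnS !binS !bin1 IHb mulnS; lia.
Qed.

Section Snake.
Variables (la mu : seq nat) (n : nat) (C : syt la mu n).
Variables (b b' : box la mu) (i j l : 'I_n).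
Hypothesis colC : is_column_reading C.
Hypothesis adj : adjacent_in_row b b'.
Hypotheses (Ci : val C i = b) (Cl : val C l = b').
Hypothesis memA : forall e : 'I_n, (i <= e <= j)%N =
  in_snake b b' (val C e) && (bcol (val C e) == bcol b).
Hypothesis memB : forall e : 'I_n, (j < e <= l)%N =
  in_snake b b' (val C e) && (bcol (val C e) == bcol b').

Let A := [set e : 'I_n | (i <= e <= j)%N].
Let B := [set e : 'I_n | (j < e <= l)%N].

Lemma snake_row : brow b' = brow b.
Proof. by have /andP[/eqP] := adj. Qed.

Lemma snake_col : bcol b' = (bcol b).+1.
Proof. by have /andP[_ /eqP] := adj. Qed.

Lemma snake_ij : (i <= j)%N.
Proof. by have := memA i; rewrite Ci /in_snake !eqxx !leqnn /= => /esym. Qed.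

Lemma snake_jl : (j < l)%N.
Proof.
by have := memB l; rewrite Cl /in_snake !eqxx !leqnn orbT /= andbT => /esym.
Qed.

Lemma snake_iA : i \in A.
Proof. by rewrite inE leqnn snake_ij. Qed.

Lemma snake_lB : l \in B.
Proof. by rewrite inE leqnn snake_jl. Qed.

Lemma snake_AB e : (e \in A :|: B) = (i <= e <= l)%N.
Proof. by have := snake_ij; have := snake_jl; rewrite !inE; lia. Qed.

Lemma snake_convexAB : convex (A :|: B).
Proof. by move=> x y z; rewrite !snake_AB; lia. Qed.

Lemma snakeA e : e \in A -> bcol (val C e) = bcol b /\ (brow b <= brow (val C e))%N.
Proof.
rewrite inE memA /in_snake => /andP[H /eqP cE]; split=> //.
by move: H; rewrite cE snake_col eqxx /= => /orP[//|/andP[/eqP]]; lia.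
Qed.

Lemma snakeB e : e \in B -> bcol (val C e) = bcol b' /\ (brow (val C e) <= brow b)%N.
Proof.
rewrite inE memB /in_snake => /andP[H /eqP cE]; split=> //.
by move: H; rewrite cE snake_row snake_col eqxx /= => /orP[/andP[/eqP]|//]; lia.
Qed.

Lemma snakeE e : (e \in A :|: B) = in_snake b b' (val C e).
Proof.
rewrite in_setU [e \in A]inE [e \in B]inE memA memB -andb_orr /in_snake.
by case: (bcol _ == _) => //=; case: (bcol _ == _) => //=; rewrite ?andbT ?andbF.
Qed.

Lemma column_reading_row e f : bcol (val C e) = bcol (val C f) ->
  (e < f)%N = (brow (val C e) < brow (val C f))%N.
Proof. by move=> cE; rewrite colC /col_lt cE ltnn eqxx. Qed.

(** Increase along the two columns is minimality of the representative. Rows add a single condition: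
    the left column of the snake lies weakly below the row of [b] and the right column weakly above
    it, so only [b] and [b'] share a row. Entries outside the interval [A :|: B] keep their order
    relative to it. *)
Lemma snake_standardP u : u \in Sym (A :|: B) ->
  is_standard (perm_filling u (val C)) = (u \in min_coset_reps A B) && (u i < u l)%N.
Proof.
move=> uAB; have repsP := min_coset_repsP (@interval_convex n i j)
  (@interval_convex n j.+1 l)  snake_convexAB (@interval_ltn n i j l) u.
apply/perm_filling_standardP/andP => [H|[/repsP[_ uA uB] ltu] e f H].
  split; last by apply: H; left; rewrite Ci Cl snake_row snake_col leqnn.
  apply/repsP; split=> // e f eS fS ltef; apply: H; right.
    have [eC _] := snakeA eS; have [fC _] := snakeA fS.
    by rewrite -column_reading_row eC ?fC.
  have [eC _] := snakeB eS; have [fC _] := snakeB fS.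
  by rewrite -column_reading_row eC ?fC.
have ltef : (e < f)%N by case: H => -[]; [exact: syt_row | exact: syt_col].
have [/andP[]|nS] := boolP ((e \in A :|: B) && (f \in A :|: B)); last first.
  exact: (Sym_lt_outside snake_convexAB).
rewrite !in_setU => /orP[eA|eB] /orP[fA|fB].
- exact: uA.
- have [eC eR] := snakeA eA; have [fC fR] := snakeB fB.
  rewrite eC fC snake_col in H; have {H} [[rE _]|[]] := H; last lia.
  have -> : e = i.
    by apply: (bij_inj (syt_bij C)); apply: box_inj; rewrite Ci //; lia.
  suff -> : f = l by [].
  apply: (bij_inj (syt_bij C)); apply: box_inj; rewrite Cl //.
  by rewrite snake_row; lia.
- by have := interval_ltn fA eB; lia.
- exact: uB.
Qed.

(* In row reading order b' comes immediately after b; hence exchanging the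
   entries of b and b' in P gives the only filling of the snake that is
   increasing along both columns but not along the row of b. *)
Section RowReading.
Variables (P : syt la mu n) (k : 'I_n.-1).
Hypothesis Pout : forall e : 'I_n, ~~ in_snake b b' (val C e) -> val P e = val C e.
Hypothesis Prow : forall e f : 'I_n, in_snake b b' (val P e) ->
  in_snake b b' (val P f) -> (e < f)%N = row_lt (val P e) (val P f).
Hypothesis Pk : val P (ord_lo k) = b.

Let uP := tab_perm C P.

Lemma row_reading_Sym : uP \in Sym (A :|: B).
Proof.
apply/SymP => e; rewrite snakeE => /Pout PE.
by apply: (bij_inj (syt_bij P)); rewrite PE -(tab_permP C P) perm_filling_permE.
Qed.

Lemma row_readingE e : val P (uP e) = val C e.
Proof. by rewrite -(tab_permP C P) perm_filling_permE. Qed.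

Lemma row_reading_lt e f : e \in A :|: B -> f \in A :|: B ->
  (uP e < uP f)%N = row_lt (val C e) (val C f).
Proof. by rewrite !snakeE -!row_readingE => ? ?; rewrite Prow. Qed.

Lemma row_reading_i : uP i = ord_lo k.
Proof. by apply: (bij_inj (syt_bij P)); rewrite row_readingE Ci Pk. Qed.

(** No box of the snake comes strictly between [b] and [b'] in row reading order, and the entries of
    the snake form an interval, so the entry after that of [b] is in [b']. *)
Lemma row_reading_l : uP l = ord_hi k.
Proof.
have iS : i \in A :|: B by rewrite inE snake_iA.
have lS : l \in A :|: B by rewrite inE snake_lB orbT.
have lt_il : (uP i < uP l)%N.
  by rewrite row_reading_lt // /row_lt Ci Cl snake_row snake_col ltnn eqxx leqnn.
apply: val_inj => /=; apply/eqP; rewrite eqn_leq andbC.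
rewrite row_reading_i /= in lt_il; rewrite lt_il leqNgt; apply/negP => lt_k.
have kS : ord_hi k \in A :|: B.
  apply: (snake_convexAB (x := uP i) (z := uP l));
    rewrite ?Sym_closed ?row_reading_Sym //.
  by rewrite row_reading_i /=; lia.
set e := (uP^-1)%g (ord_hi k).
have eS : e \in A :|: B by rewrite (Sym_closedV _ row_reading_Sym).
have := row_reading_lt iS eS; have := row_reading_lt eS lS.
rewrite permKV row_reading_i Ci Cl lt_k /= leqnn /row_lt snake_row snake_col.
move: eS; rewrite in_setU => /orP[/snakeA|/snakeB] [-> ?]; rewrite ?snake_col; lia.
Qed.

Let w := (uP * simple_tperm k)%g.

Lemma row_reading_max : [/\ w \in min_coset_reps A B,
  {in A & B, forall x y : 'I_n, (w y < w x)%N} &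
  forall u, u \in Sym (A :|: B) ->
    (u \in min_coset_reps A B) && ~~ (u i < u l)%N = (u == w)].
Proof.
have cAB := snake_convexAB.
have cA := @interval_convex n i j; have cB := @interval_convex n j.+1 l.
have ltAB := @interval_ltn n i j l; have hyps := min_coset_repsP cA cB cAB ltAB.
have uPR : uP \in min_coset_reps A B.
  have := snake_standardP row_reading_Sym; rewrite (tab_permP C P) (valP P).
  by move=> /esym/andP[].
have wR : w \in min_coset_reps A B.
  apply: (min_coset_reps_step cA cB cAB ltAB) => //.
  - by rewrite -row_reading_i permK snake_iA.
  - by rewrite -row_reading_l permK snake_lB.
(* Since [i] is least in [A] and [l] greatest in [B], one gets [u y <= u l < u i <= u x]. *)
have max_of u : u \in min_coset_reps A B -> (u l < u i)%N ->
    {in A & B, forall x y : 'I_n, (u y < u x)%N}.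
  move=> /hyps[_ uA uB] lt_u x y xA yB.
  have le_x : (u i <= u x)%N.
    have [->//|xi] := eqVneq x i; apply/ltnW/uA; rewrite ?snake_iA //.
    by move: xi xA; rewrite inE -val_eqE /=; lia.
  have le_y : (u y <= u l)%N.
    have [->//|yl] := eqVneq y l; apply/ltnW/uB; rewrite ?snake_lB //.
    by move: yl yB; rewrite inE -val_eqE /=; lia.
  by lia.
have wmax : (w l < w i)%N.
  by rewrite !permM row_reading_i row_reading_l /simple_tperm tpermL tpermR /=.
split; [by [] | exact: max_of | move=> u uAB].
apply/andP/eqP => [[uR]|->]; last by rewrite wR -leqNgt ltnW.
rewrite -leqNgt leq_eqVlt => /orP[/eqP/val_inj/perm_inj il|lt_u].
  by have := interval_ltn snake_iA snake_lB; rewrite il ltnn.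
apply: (min_coset_reps_max_uniq cA cB cAB ltAB) => //.
  exact: max_of.
exact: max_of.
Qed.

End RowReading.
End Snake.

(** * Contents *)

Section Contents.
Variables (R : realType) (q : R) (la mu : seq nat) (c : box la mu -> R[i]) (n : nat).
Hypothesis placed : is_placed_skew_shape q c.

Lemma content_below (x y : box la mu) : bcol x = bcol y -> brow y = (brow x).+1 ->
  c x = c y + 1.
Proof.
have [_ _ _ H _] := placed => cE rE; apply/H.
by rewrite /bdiag cE rE; lia.
Qed.

Lemma content_right (x y : box la mu) : bcol y = (bcol x).+1 -> brow y = brow x ->
  c y = c x + 1.
Proof.
have [_ _ _ H _] := placed => cE rE; apply/H.
by rewrite /bdiag cE rE; lia.
Qed.

Variable C : syt la mu n.
Hypothesis colC : is_column_reading C.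

Lemma content_same_column (i : 'I_n.-1) :
  bcol (val C (ord_lo i)) = bcol (val C (ord_hi i)) ->
  c (val C (ord_lo i)) = c (val C (ord_hi i)) + 1.
Proof.
have [sk _ _ _ _] := placed.
by move=> cE; apply: content_below (column_reading_next sk colC cE).
Qed.

(** Each next entry of the column sits one box lower, where the content is smaller by 1. *)
Lemma content_column (S : {set 'I_n}) (s : nat) : convex S ->
  {in S, forall e, bcol (val C e) = s} ->
  {in S &, forall e f : 'I_n, (e <= f)%N ->
    exists d : nat, c (val C e) - c (val C f) = d%:R}.
Proof.
move=> cS colS e [f lt_f] eS; elim: f lt_f => [|f IHf] lt_f fS /= le_ef.
  exists 0; rewrite (_ : Ordinal _ = e) ?subrr //; apply: val_inj => /=; lia.
have [ef|ef] := eqVneq (e : nat) f.+1.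
  by exists 0; rewrite (_ : Ordinal _ = e) ?subrr //; apply: val_inj => /=; lia.
have lt_f1 : (f < n.-1)%N by lia.
have fE : Ordinal lt_f = ord_hi (Ordinal lt_f1) by apply: val_inj.
have f'E : Ordinal (ltnW lt_f) = ord_lo (Ordinal lt_f1) by apply: val_inj.
have f'S : Ordinal (ltnW lt_f) \in S by apply: (cS e _ _ eS fS) => /=; lia.
have [|d dE] := IHf (ltnW lt_f) f'S; first by move=> /=; lia.
exists d.+1; rewrite -natr1 -dE fE f'E content_same_column -?fE -?f'E ?colS //.
by rewrite opprD addrA subrK.
Qed.

End Contents.

(** * Values of the diagonal coefficients of [T_i] *)

Section Tdiag.
Variables (R : realType) (q : R) (la mu : seq nat) (c : box la mu -> R[i]) (n : nat).
Hypotheses (q_gt0 : 0 < q) (q_neq1 : q != 1).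

Lemma q2pow_real (r : R) : q2pow q r%:C = (expR (r * ln (q ^+ 2)))%:C.
Proof.
by rewrite /q2pow -rmorphM /cexp /= cos0 sin0 mulr1 mulr0.
Qed.

Lemma qC_neq0 : q%:C != 0.
Proof. by rewrite fmorph_eq0 gt_eqF. Qed.

Lemma ln_q2_neq0 : ln (q ^+ 2) != 0.
Proof.
rewrite ln_eq0 ?exprn_gt0 // sqrf_eq1 (negPf q_neq1) /=.
by apply: contraTneq q_gt0 => ->; rewrite -leNgt lerN10.
Qed.

Lemma q2pow1 : q2pow q 1 = q%:C ^+ 2.
Proof. by rewrite (q2pow_real 1) mul1r lnK ?rmorphXn // posrE exprn_gt0. Qed.

(** The coefficient becomes [(q - q^-1) / (1 - q^2)], whose denominator is nonzero because
    [ln (q ^+ 2)] is. *)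
Lemma Tdiag_eq (i : 'I_n.-1) (L : filling la mu n) :
  c (L (ord_lo i)) = c (L (ord_hi i)) + 1 -> Tdiag q c i L = - q%:C^-1.
Proof.
move=> cE; rewrite /Tdiag cE addrAC subrr add0r q2pow1.
have q21 : 1 - q%:C ^+ 2 != 0.
  rewrite -rmorphXn subr_eq0 eq_sym.
  apply: contraTneq isT => /complexI q21.
  by have := ln_q2_neq0; rewrite q21 ln1 eqxx.
apply: (mulIf q21); rewrite divfK //; have := qC_neq0 => q0; field.
exact: q0.
Qed.

(** Equality would force [q^(2r) = q^2]; the real exponential is injective and [ln (q ^+ 2)] is
    nonzero, so [r] would be 1. *)
Lemma Tdiag_neq (i : 'I_n.-1) (L : filling la mu n) (r : R) : r != 1 ->
  c (L (ord_lo i)) - c (L (ord_hi i)) = r%:C -> Tdiag q c i L != - q%:C^-1.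
Proof.
move=> r1 cE; rewrite /Tdiag cE q2pow_real; set X := (expR _)%:C; have q0 := qC_neq0.
(* When the denominator vanishes its inverse is 0 by convention, so the coefficient is 0 and still
   differs from [- q^-1]. *)
have [X1|X1] := eqVneq (1 - X) 0.
  by rewrite X1 invr0 mulr0 eq_sym oppr_eq0 invr_eq0.
apply: contra_neq r1 => TE; have XE : X = q%:C ^+ 2.
  have /(congr1 (fun z => z * (1 - X) * q%:C)) := TE.
  rewrite divfK // mulrBl mulVf // => E.
  have -> : X = 1 - (1 - X) by ring.
  have -> : 1 - X = - (- q%:C^-1 * (1 - X) * q%:C) by field.
  by rewrite -E; ring.
move: XE; rewrite -q2pow1 (q2pow_real 1) => /complexI/expR_inj.
by move/(mulIf ln_q2_neq0).
Qed.

End Tdiag.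

(** * The skew module *)

Section AlgebraModules.
Variables (K : comNzRingType) (H : algType K) (M : lmodType H).
Implicit Types (a b : K) (h : H) (m : M).

(** Scalars act on [M] through multiples of the unit of the algebra; these identities recover the
    vector space rules and the linearity of the action. *)
Lemma scale_algA a b m : a%:A *: (b%:A *: m) = (a * b)%:A *: m.
Proof. by rewrite scalerA mulr_algl scalerA. Qed.

Lemma scale_algC a h m : h *: (a%:A *: m) = a%:A *: (h *: m).
Proof. by rewrite !scalerA mulr_algr mulr_algl. Qed.

Lemma scale_algZ a h m : (a *: h) *: m = a%:A *: (h *: m).
Proof. by rewrite scalerA mulr_algl. Qed.

Lemma scale_algD a b m : (a + b)%:A *: m = a%:A *: m + b%:A *: m.
Proof. by rewrite scalerDl scalerDl. Qed.

Lemma scale_alg1 m : (1 : K)%:A *: m = m.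
Proof. by rewrite scale1r scale1r. Qed.

End AlgebraModules.

Section SkewModule.
Variables (R : realType) (q : R) (la mu : seq nat) (c : box la mu -> R[i]) (n : nat).
Local Notation H := (affine_hecke n q%:C).
Variables (M : lmodType H) (v : syt la mu n -> M).
Implicit Types (L : syt la mu n) (m : 'I_n.-1) (y : M) (a : R[i]).

(** Bijectivity of this map is the basis condition in [is_skew_module]; its inverse [crd] reads off
    coordinates. *)
Definition comb (a : {ffun syt la mu n -> R[i]}) : M := \sum_L (a L)%:A *: v L.

Variable crd : M -> {ffun syt la mu n -> R[i]}.
Hypotheses (crdK : cancel crd comb) (combK : cancel comb crd).
Hypothesis Tv : forall m L, heckeT q%:C m *: v L =
  (Tdiag q c m (val L))%:A *: v L + (q%:C^-1 + Tdiag q c m (val L))%:A *: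
    std_or_0 v (perm_filling (simple_tperm m) (val L)).

Lemma crdD y y' L : crd (y + y') L = crd y L + crd y' L.
Proof.
have -> : y + y' = comb [ffun L => crd y L + crd y' L].
  rewrite -{1}(crdK y) -{1}(crdK y') /comb -big_split /=.
  by apply: eq_bigr => L' _; rewrite ffunE scale_algD.
by rewrite combK ffunE.
Qed.

Lemma crdZ a y L : crd (a%:A *: y) L = a * crd y L.
Proof.
have -> : (a%:A : H) *: y = comb [ffun L => a * crd y L].
  rewrite -{1}(crdK y) /comb scaler_sumr.
  by apply: eq_bigr => L' _; rewrite ffunE scale_algA.
by rewrite combK ffunE.
Qed.

Lemma crd0 L : crd 0 L = 0.
Proof. by have := crdZ 0 0 L; rewrite scaler0 mul0r. Qed.

Lemma crd_sum (I : finType) (P : pred I) (F : I -> M) L :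
  crd (\sum_(i | P i) F i) L = \sum_(i | P i) crd (F i) L.
Proof. by apply: (big_morph (fun y => crd y L)) => [y y'|]; rewrite ?crdD ?crd0. Qed.

Lemma crd_eq0 y : (forall L, crd y L = 0) -> y = 0.
Proof.
move=> y0; rewrite -(crdK y) /comb big1 // => L _.
by rewrite y0 scale0r scale0r.
Qed.

Lemma crd_v L L' : crd (v L) L' = (L == L')%:R.
Proof.
have -> : v L = comb [ffun L' => (L == L')%:R].
  rewrite /comb (bigD1 L) //= ffunE eqxx scale_alg1 big1 ?addr0 // => L'' LN.
  by rewrite ffunE eq_sym (negPf LN) scale0r scale0r.
by rewrite combK ffunE.
Qed.

Lemma crd_std_or_0 F L : crd (std_or_0 v F) L = (F == val L)%:R.
Proof.
have [L' <-|FN] := stdP F; first by rewrite std_or_0_val crd_v.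
rewrite std_or_0_nonstd // crd0; case: eqP => // FE.
by move: FN; rewrite FE (valP L).
Qed.

Lemma perm_filling_simpleK m (F : filling la mu n) :
  perm_filling (simple_tperm m) (perm_filling (simple_tperm m) F) = F.
Proof.
by rewrite -perm_fillingM simple_tperm2; apply/ffunP => e; rewrite ffunE invg1 perm1.
Qed.

(** [v L] occurs only in the images of [v L] and of the vector at [s_m L], so the second coefficient
    is taken at [s_m L]; it multiplies 0 when that filling is not standard. *)
Lemma crdT m y L : crd (heckeT q%:C m *: y) L =
  Tdiag q c m (val L) * crd y L +
  (q%:C^-1 + Tdiag q c m (perm_filling (simple_tperm m) (val L))) *
    std_or_0 (crd y) (perm_filling (simple_tperm m) (val L)).
Proof.
set s := perm_filling _; pose Q F := q%:C^-1 + Tdiag q c m F.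
have step L' : crd (heckeT q%:C m *: ((crd y L')%:A *: v L')) L =
    crd y L' * (Tdiag q c m (val L') * (L' == L)%:R +
      Q (val L') * (val L' == s (val L))%:R).
  rewrite scale_algC Tv crdZ crdD !crdZ crd_v crd_std_or_0 -/s.
  suff -> : (s (val L') == val L) = (val L' == s (val L)) by [].
  by apply/eqP/eqP => [<-|->]; rewrite /s perm_filling_simpleK.
rewrite -{1}(crdK y) /comb scaler_sumr crd_sum (eq_bigr _ (fun L' _ => step L')).
rewrite (eq_bigr _ (fun L' _ => mulrDr _ _ _)) big_split /=; congr (_ + _).
  rewrite (bigD1 L) //= eqxx mulr1 mulrC big1 ?addr0 // => L' /negPf->.
  by rewrite !mulr0.
rewrite -/(Q _); have [L0 L0E|sN] := stdP (s (val L)).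
  rewrite -L0E std_or_0_val (bigD1 L0) //= eqxx mulr1 mulrC big1 ?addr0 //.
  by move=> L' /negPf; rewrite -val_eqE => ->; rewrite !mulr0.
rewrite std_or_0_nonstd // mulr0 big1 // => L' _.
case: eqP => [sE|]; last by rewrite !mulr0.
by move: sN; rewrite -sE (valP L').
Qed.

Section AgreeOutside.
Variables (C : syt la mu n) (S : {set 'I_n}).
Hypothesis cS : convex S.

(** [T_m] links only tableaux that differ by exchanging m and m+1, both in [S], so the entry [e]
    never leaves the box it has in [C]. *)
Lemma crd_word_outside (s : seq 'I_n.-1) L e :
  (forall m, m \in s -> ord_lo m \in S /\ ord_hi m \in S) ->
  e \notin S -> val L e != val C e ->
  crd ((\prod_(m <- s) heckeT q%:C m) *: v C) L = 0.
Proof.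
move=> sS eS; elim: s sS L => [|m s IHs] sS L LC.
  rewrite big_nil scale1r crd_v; have [CL|//] := eqVneq C L.
  by rewrite CL eqxx in LC.
have {}IHs : forall L, val L e != val C e ->
    crd ((\prod_(m <- s) heckeT q%:C m) *: v C) L = 0.
  by apply: IHs => m' m's; apply: sS; rewrite inE m's orbT.
have [loS hiS] := sS m (mem_head _ _).
rewrite big_cons -scalerA crdT IHs // mulr0 add0r.
have [L' L'E|sN] := stdP (perm_filling (simple_tperm m) (val L)).
  rewrite -L'E std_or_0_val IHs ?mulr0 // L'E ffunE simple_tpermV.
  rewrite /simple_tperm tpermD //; first by apply: contraNneq eS => <-.
  by apply: contraNneq eS => <-.
by rewrite std_or_0_nonstd ?mulr0.
Qed.

Lemma crd_Tw_outside u L e : u \in Sym S -> e \notin S -> val L e != val C e ->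
  crd (heckeTw q%:C u *: v C) L = 0.
Proof.
move=> uS; have [s sE sz] := perm_len_word u.
rewrite -sE in uS sz *; rewrite heckeTw_word //.
by apply: crd_word_outside; apply: Sym_reduced_letters.
Qed.

End AgreeOutside.

Hypotheses (q_gt0 : 0 < q) (q_neq1 : q != 1).
Hypothesis placed : is_placed_skew_shape q c.
Variable C : syt la mu n.
Hypothesis colC : is_column_reading C.

Lemma T_same_column m : bcol (val C (ord_lo m)) = bcol (val C (ord_hi m)) ->
  heckeT q%:C m *: v C = (- q%:C^-1)%:A *: v C.
Proof.
move=> cE; rewrite Tv Tdiag_eq //; last by apply: (content_same_column placed colC cE).
by rewrite subrr scale0r scale0r addr0.
Qed.

(** This is the quadratic relation in the form [(T_m + q^-1) (T_m - q) = 0]. *)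
Lemma heckeT_factor m : (heckeT q%:C m + q%:C^-1%:A) * heckeT q%:C m =
  q%:C *: (heckeT q%:C m + q%:C^-1%:A) :> H.
Proof.
have [_ _ TQ _ _] := affine_heckeP n q%:C.
have q0 := qC_neq0 q_gt0.
rewrite mulrDl -expr2 TQ mulr_algl scalerDr scalerA mulfV // scale1r.
by rewrite addrAC -scalerDl subrK.
Qed.

(** * The signed sum over minimal coset representatives *)

Section SnakeSum.
Variables (A B : {set 'I_n}).
Hypotheses (cA : convex A) (cB : convex B) (cAB : convex (A :|: B)).
Hypothesis ltAB : {in A & B, forall x y : 'I_n, (x < y)%N}.
Variables sA sB : nat.
Hypothesis colA : {in A, forall e, bcol (val C e) = sA}.
Hypothesis colB : {in B, forall e, bcol (val C e) = sB}.
Variable N : int.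

(** [N] stands for the difference of lengths in the theorem; changing it rescales the whole sum by a
    power of [- q]. *)
Let coef (u : 'S_n) : R[i] := (- q%:C) ^ (N - (perm_len u)%:Z).

Definition snake_vector : M :=
  \sum_(u in min_coset_reps A B) (coef u)%:A *: (heckeTw q%:C u *: v C).

Lemma coef_step u u' : perm_len u' = (perm_len u).+1 -> coef u = coef u' * - q%:C.
Proof.
move=> lenE; rewrite /coef -{3}[- q%:C]expr1z -expfzDr ?oppr_eq0 ?qC_neq0 //.
by congr (_ ^ _); rewrite lenE; lia.
Qed.

(* Up to sign, u and s_m u give the same multiple of (T_m + q^-1), since
   (T_m + q^-1) T_m = q (T_m + q^-1); if s_m u is not a minimal representative,
   then s_m u = u s_a with a, a+1 in the same column of C, and the term of u
   vanishes. *)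
Lemma snake_vector_eigen m : ord_lo m \in A :|: B -> ord_hi m \in A :|: B ->
  heckeT q%:C m *: snake_vector = (- q%:C^-1)%:A *: snake_vector.
Proof.
move=> loS hiS; have repsP := min_coset_repsP cA cB cAB ltAB.
pose D : H := heckeT q%:C m + q%:C^-1%:A.
suff D0 : D *: snake_vector = 0.
  apply/eqP; rewrite -subr_eq0 -scaleNr -scaleNr opprK -scalerDl.
  by rewrite -[X in X == _]/(D *: _) D0.
(* Extension by 0 lets the sum run over the whole symmetric group, where multiplication by [s_m] is
   an involution that pairs the terms. *)
pose F (u : 'S_n) : M := if u \in min_coset_reps A B
  then (coef u)%:A *: ((D * heckeTw q%:C u) *: v C) else 0.
have DE : D *: snake_vector = \sum_u F u.
  rewrite scaler_sumr big_mkcond; apply: eq_bigr => u _; rewrite /F.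
  by case: ifP => // _; rewrite scale_algC -scalerA.
have up u : u \in min_coset_reps A B -> (u^-1)%g (ord_lo m) \in A ->
    (u^-1)%g (ord_hi m) \in B -> F u + F (u * simple_tperm m)%g = 0.
  move=> uR loA hiB; have lt_u := ltAB loA hiB.
  rewrite /F uR min_coset_reps_step // (coef_step (perm_len_simpleR lt_u)).
  rewrite heckeTw_simpleR // mulrA heckeT_factor -/D -scalerAl.
  rewrite [((q%:C *: (D * _)) *: _)]scale_algZ.
  by rewrite scale_algA -scale_algD mulrN addNr scale0r scale0r.
have same (u : 'S_n) (S : {set 'I_n}) s : convex S ->
    {in S, forall e, bcol (val C e) = s} -> {in S &, {homo u : x y / (x < y)%N}} ->
    u \in min_coset_reps A B ->
    (forall w : 'S_n, w \in min_coset_reps A B ->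
      {in S &, {homo w : x y / (x < y)%N}}) ->
    (u^-1)%g (ord_lo m) \in S -> (u^-1)%g (ord_hi m) \in S ->
    F u + F (u * simple_tperm m)%g = 0.
  move=> cS colS uS uR homS uloS uhiS.
  have [a [loa hia ulo uhi uE]] := incr_same_block cS uS uloS uhiS.
  have lt_a : (u (ord_lo a) < u (ord_hi a))%N by rewrite ulo uhi /=.
  rewrite /F uR ifN; last first.
    apply/negP => /homS /(_ _ _ loa hia (leqnn _)).
    by rewrite !permM ulo uhi /simple_tperm tpermL tpermR /=; lia.
  have lt_u : ((u^-1)%g (ord_lo m) < (u^-1)%g (ord_hi m))%N.
    by rewrite -ulo -uhi !permK /=.
  rewrite addr0 mulrDl -(heckeTw_simpleR q%:C lt_u) uE heckeTw_simpleL //.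
  rewrite scalerDl -scalerA T_same_column ?colS // scale_algC.
  rewrite mulr_algl [(q%:C^-1 *: heckeTw _ _) *: _]scale_algZ.
  by rewrite -scale_algD addNr scale0r scale0r scaler0.
have key u : u \in min_coset_reps A B -> F u + F (u * simple_tperm m)%g = 0.
  move=> uR; have [uAB uA uB] := repsP u uR.
  have ulo : (u^-1)%g (ord_lo m) \in A :|: B by rewrite (Sym_closedV _ uAB).
  have uhi : (u^-1)%g (ord_hi m) \in A :|: B by rewrite (Sym_closedV _ uAB).
  move: ulo uhi; rewrite !in_setU => /orP[loA|loB] /orP[hiA|hiB].
  - by apply: (same u A sA) => // w /repsP[].
  - exact: up.
  - have u'R := min_coset_reps_stepV cA cB cAB ltAB uR loB hiA.
    rewrite addrC -{2}(mulg_simple_tpermK m u); apply: up => //.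
      by rewrite invMg simple_tpermV permM /simple_tperm tpermL.
    by rewrite invMg simple_tpermV permM /simple_tperm tpermR.
  - by apply: (same u B sB) => // w /repsP[].
have FK u : F u + F (u * simple_tperm m)%g = 0.
  have [uR|uR] := boolP (u \in min_coset_reps A B); first exact: key.
  have [u'R|u'R] := boolP ((u * simple_tperm m)%g \in min_coset_reps A B).
    by rewrite addrC -{2}(mulg_simple_tpermK m u) key.
  by rewrite /F (negPf uR) (negPf u'R) addr0.
(* Adding the sum to its reindexed copy makes every pair cancel, so twice the vector is 0, and 2 is
   invertible. *)
have D2 : D *: snake_vector + D *: snake_vector = 0.
  rewrite DE {2}(reindex_inj (mulIg (simple_tperm m))) -big_split /=.
  by rewrite big1 // => u _; exact: FK.
have half : 2^-1 + 2^-1 = 1 :> R[i] by rewrite [RHS]splitr mul1r.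
by rewrite -[LHS]scale_alg1 -half scale_algD -scalerDr D2 scaler0.
Qed.

Hypothesis content_lt : {in A & B, forall x y : 'I_n, exists2 r : R,
  r < 0 & c (val C x) - c (val C y) = r%:C}.
Hypothesis max_nonstd : forall u, u \in min_coset_reps A B ->
  {in A & B, forall x y : 'I_n, (u y < u x)%N} ->
  ~~ is_standard (perm_filling u (val C)).
Hypothesis std_reps : forall u, u \in Sym (A :|: B) ->
  is_standard (perm_filling u (val C)) -> u \in min_coset_reps A B.

Lemma snake_vector_eq0 : snake_vector = 0.
Proof.
have repsP := min_coset_repsP cA cB cAB ltAB.
(* Descending induction on the length: [d] bounds the distance to [#|A| * #|B|], the greatest
   possible length. *)
have reps0 d u : u \in min_coset_reps A B -> (#|A| * #|B| - perm_len u < d)%N ->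
    std_or_0 (crd snake_vector) (perm_filling u (val C)) = 0.
  elim: d u => [//|d IHd] u uR lt_d; have [uAB uA uB] := repsP u uR.
  have [/existsP[m /andP[loA hiB]]|noP] :=
      boolP [exists m, ((u^-1)%g (ord_lo m) \in A) && ((u^-1)%g (ord_hi m) \in B)];
      last first.
    apply: std_or_0_nonstd; apply: max_nonstd => //.
    apply: (min_coset_reps_max cA cB cAB ltAB uR) => m loA hiB.
    by case/existsP: noP; exists m; rewrite loA.
  have u'R := min_coset_reps_step cA cB cAB ltAB uR loA hiB.
  have lenE := perm_len_simpleR (ltAB loA hiB).
  (* Without this bound the truncated subtraction could stall at 0; with it the distance strictly
     drops. *)
  have len_le : (perm_len (u * simple_tperm m)%g <= #|A| * #|B|)%N.
    have [u'AB u'A u'B] := repsP _ u'R.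
    by rewrite perm_lenE -cardsX subset_leq_card ?inversions_blocks.
  have lt_d' : (#|A| * #|B| - perm_len (u * simple_tperm m)%g < d)%N.
    by rewrite lenE in len_le *; move: (#|A| * #|B|)%N lt_d len_le => p; lia.
  have u'0 := IHd _ u'R lt_d'; rewrite perm_fillingM in u'0.
  have loS : ord_lo m \in A :|: B by rewrite -(Sym_closedV _ uAB) inE loA.
  have hiS : ord_hi m \in A :|: B by rewrite -(Sym_closedV _ uAB) inE hiB orbT.
  have [L LE|] := stdP (perm_filling u (val C)); last exact: std_or_0_nonstd.
  rewrite -LE in u'0 *; rewrite std_or_0_val.
  have /(congr1 (fun y => crd y L)) := snake_vector_eigen loS hiS.
  rewrite crdT u'0.
  rewrite mulr0 addr0 crdZ => /eqP; rewrite -subr_eq0 -mulrBl mulf_eq0.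
  have [r r0 rE] := content_lt loA hiB.
  rewrite subr_eq0 (negPf (Tdiag_neq q_gt0 q_neq1 (r := r) _ _)) => [/eqP//||].
    by apply: contraTneq r0 => ->; rewrite -leNgt.
  by rewrite LE !ffunE.
apply: crd_eq0 => L.
(* A tableau agreeing with [C] outside [A :|: B] is [uC] for some [u] in [Sym (A :|: B)]; at any
   other tableau each term of the sum has coordinate 0. *)
have [/forallP LC|] := boolP [forall e, (e \notin A :|: B) ==> (val L e == val C e)].
  have uAB : tab_perm C L \in Sym (A :|: B).
    apply/SymP => e eN; apply: (bij_inj (syt_bij L)).
    rewrite -{1}(tab_permP C L) perm_filling_permE.
    by apply/esym/eqP/(implyP (LC e)).
  rewrite -std_or_0_val -(tab_permP C L); apply: (reps0 _ _ _ (leqnn _)).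
  by apply: std_reps => //; rewrite tab_permP (valP L).
rewrite negb_forall => /existsP[e]; rewrite negb_imply => /andP[eN LC].
rewrite crd_sum big1 // => u /repsP[uAB _ _].
by rewrite crdZ (crd_Tw_outside cAB uAB eN LC) mulr0.
Qed.

End SnakeSum.
End SkewModule.

(** * Assembly of the two formulas in the natural basis *)

Lemma natural_basis_C (R : realType) (q : R) (la mu : seq nat) (n : nat)
    (M : lmodType (affine_hecke n q%:C)) (v : syt la mu n -> M) (C : syt la mu n) :
  natural_basis v C C = v C.
Proof. by rewrite /natural_basis tab_perm_id heckeTw1 scale1r. Qed.

Theorem theorem5p5 (R : realType) (n : nat) (q : R) (la mu : seq nat)
    (c : box la mu -> R[i]) (M : lmodType (affine_hecke n q%:C))
    (v : syt la mu n -> M) (C : syt la mu n) :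
  (0 < n)%N -> 0 < q -> q != 1 ->
  is_placed_skew_shape q c -> #|{: box la mu}| = n ->
  is_skew_module c v -> is_column_reading C ->
  let nb := natural_basis v C in
  (forall i : 'I_n.-1,
     bcol (val C (ord_lo i)) = bcol (val C (ord_hi i)) ->
     heckeT q%:C i *: nb C = (- q%:C^-1)%:A *: nb C)
  /\
  (forall (b b' : box la mu) (i j l : 'I_n) (P : syt la mu n) (k : 'I_n.-1),
     adjacent_in_row b b' ->
     val C i = b -> val C l = b' ->
     (forall e : 'I_n, (i <= e <= j)%N =
        in_snake b b' (val C e) && (bcol (val C e) == bcol b)) ->
     (forall e : 'I_n, (j < e <= l)%N =
        in_snake b b' (val C e) && (bcol (val C e) == bcol b')) ->
     (forall e : 'I_n, ~~ in_snake b b' (val C e) -> val P e = val C e) ->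
     (forall e f : 'I_n, in_snake b b' (val P e) -> in_snake b b' (val P f) ->
        (e < f)%N = row_lt (val P e) (val P f)) ->
     val P (ord_lo k) = b ->
     let A := [set e : 'I_n | (i <= e <= j)%N] in
     let B := [set e : 'I_n | (j < e <= l)%N] in
     let coef (u : 'S_n) : R[i] :=
       (- q%:C) ^ ('C(l - i + 1, 2)%:Z
                   - ('C(j - i + 1, 2)%:Z + 'C(l - j, 2)%:Z)
                   - (perm_len u)%:Z) in
     let snake_sum : affine_hecke n q%:C :=
       \sum_(u in min_coset_reps A B) coef u *: heckeTw q%:C u in
     [/\ val P (ord_hi k) = b',
         0 = snake_sum *: nb C
       & snake_sum *: nb C =
           heckeT q%:C k *: nb P
           + \sum_(u in Sym (A :|: B) | is_standard (perm_filling u (val C)))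
                (coef u)%:A *: std_or_0 nb (perm_filling u (val C))]).
Proof.
move=> _ q_gt0 q_neq1 placed _ [[crd combK crdK] _ Tv] colC nb.
have nbC : nb C = v C by exact: natural_basis_C.
split=> [i cE|b b' i j l P k adj Ci Cl memA memB Pout Prow Pk A B coef snake_sum].
  by rewrite nbC (T_same_column Tv q_gt0 q_neq1 placed colC cE).
have ij := snake_ij Ci memA; have jl := snake_jl Cl memB.
have cA := @interval_convex n i j; have cB := @interval_convex n j.+1 l.
have ltAB := @interval_ltn n i j l.
have cAB := snake_convexAB adj Ci Cl memA memB.
have stdE := snake_standardP colC adj Ci Cl memA memB.
have repsP := min_coset_repsP cA cB cAB ltAB.
have inA := snakeA adj memA; have inB := snakeB adj memB.
have iA := snake_iA Ci memA; have lB := snake_lB Cl memB.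
have [wR wmax wE] := row_reading_max colC adj Ci Cl memA memB Pout Prow Pk.
set uP := tab_perm C P in wR wmax wE; set w := (uP * simple_tperm k)%g in wR wmax wE.
have uPi := row_reading_i Ci Pk.
have uPl := row_reading_l adj Ci Cl memA memB Pout Prow Pk.
have sumE : snake_sum *: nb C =
    \sum_(u in min_coset_reps A B) (coef u)%:A *: (heckeTw q%:C u *: v C).
  by rewrite nbC scaler_suml; apply: eq_bigr => u _; rewrite scale_algZ.
have colA : {in A, forall e, bcol (val C e) = bcol b} by move=> e /inA[].
have colB : {in B, forall e, bcol (val C e) = bcol b'} by move=> e /inB[].
have sum0 : snake_sum *: nb C = 0.
  rewrite sumE.
  apply: (snake_vector_eq0 crdK combK Tv q_gt0 q_neq1 placed colC cA cB cAB ltAB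
    (sA := bcol b) (sB := bcol b')).
  - exact: colA.
  - exact: colB.
  - move=> x y xA yB.
    have ix : (i <= x)%N by move: xA; rewrite inE => /andP[].
    have yl : (y <= l)%N by move: yB; rewrite inE => /andP[].
    have [d1 d1E] := content_column placed colC cA colA iA xA ix.
    have [d2 d2E] := content_column placed colC cB colB yB lB yl.
    (* The content drops by [d1] from [b] to the box of [x] and by [d2] from the box of [y] to [b'],
       and it rises by 1 from [b] to [b']. *)
    exists (- (d1 + d2).+1%:R); first by rewrite oppr_lt0 ltr0Sn.
    have := content_right placed (snake_col adj) (snake_row adj).
    rewrite -Ci -Cl => bE; rewrite rmorphN rmorph_nat -natr1 natrD -d1E -d2E bE.
    by ring.
  - move=> u uR umax; rewrite stdE; last by have [] := repsP u uR.
    by rewrite uR /= -leqNgt ltnW ?umax.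
  - by move=> u uAB; rewrite stdE // => /andP[].
split=> //; first by rewrite -uPl -Cl -(tab_permP C P) perm_filling_permE.
(* The longest representative inverts every pair of [A] and [B], so its length is [#|A| * #|B|],
   which by [bin2_add] is the difference of the binomials: the exponent is 0. *)
have lenw : coef w = 1.
  rewrite /coef (perm_len_max cA cB cAB ltAB wR wmax).
  rewrite (@card_interval n i j.+1) // (@card_interval n j.+1 l.+1) // subSS.
  rewrite (_ : l - i + 1 = (j - i + 1) + (l - j))%N ?bin2_add; last by lia.
  rewrite (_ : j.+1 - i = j - i + 1)%N; last by rewrite subSn // addn1.
  move: (j - i + 1)%N (l - j)%N => a d.
  have cancel3 (x y z : int) : x + y + z - (x + y) - z = 0 by ring.
  by rewrite 2!PoszD cancel3 expr0z.
rewrite sumE (bigD1 w) //= lenw scale_alg1; congr (_ + _).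
  (* [w] is [s_k] after [uP] and longer by one, so [T_w] applied to [n_C] is [T_k] applied to
     [n_P]. *)
  rewrite heckeTw_simpleR ?scalerA // -uPi -uPl !permK.
  exact: leq_ltn_trans ij jl.
(* By [wE] the representatives other than [w] are exactly the [u] in [Sym (A :|: B)] for which [uC]
   is standard. *)
apply: eq_big => [u|u /andP[uR uw]].
  have [uAB|uAB] := boolP (u \in Sym (A :|: B)).
    rewrite stdE //= ; case uR : (u \in _) => //=; have := wE u uAB.
    by rewrite uR /= => <-; rewrite negbK.
  by rewrite /=; apply/andP => -[/repsP[]]; rewrite (negPf uAB).
have [uAB _ _] := repsP u uR.
have uS : is_standard (perm_filling u (val C)).
  rewrite stdE // uR /=; apply: contraR uw => ul; rewrite -wE // uR.
  exact: ul.
have [L LE|] := stdP (perm_filling u (val C)); last by rewrite uS.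
by rewrite -LE std_or_0_val /nb /natural_basis (tab_perm_eq (esym LE)).
Qed.
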